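(* There is a sequence $(L_i)_{i\in\mathbb N}$ of positive numbers such that, for each $i\in\mathbb N$, zero is an eigenvalue of $L_\Delta$ in $(-L_i,L_i)$, and such that for every $L>0$ the eigenvalues of $L_\Delta$ in $(-L,L)$ are given by $$\lambda_i=2\ln(L_i/L),\qquad i\in\mathbb N.$$
   Context: For a bounded open interval $\Omega\subset\mathbb R$, $\mathbb H(\Omega)$ is the space of $u\in L^2(\mathbb R)$ with $u=0$ on $\mathbb R\setminus\Omega$ and $\int_{\mathbb R}\int_{x-1}^{x+1}\frac{|u(x)-u(y)|^2}{|x-y|}\,dy\,dx<\infty$. The bilinear form associated with the logarithmic Laplacian $L_\Delta$ (the operator with Fourier symbol $2\ln|\xi|$) is $$\mathcal E_L(u,v)=\frac12\int_{\mathbb R}\int_{x-1}^{x+1}\frac{(u(x)-u(y))(v(x)-v(y))}{|x-y|}\,dy\,dx-\iint_{|x-y|\ge1}\frac{u(x)v(y)}{|x-y|}\,dx\,dy+\rho_1\int_{\mathbb R}uv\,dx,$$ with $\rho_1=2\ln2+\psi(\tfrac12)-\gamma$, $\psi=\Gamma'/\Gamma$, $\gamma=-\Gamma'(1)$. A number $\lambda\in\mathbb R$ is a (Dirichlet) eigenvalue of $L_\Delta$ in $\Omega$ if there is $u\in\mathbb H(\Omega)\setminus\{0\}$ with $\mathcal E_L(u,v)=\lambda\int_\Omega uv\,dx$ for all $v\in\mathbb H(\Omega)$. The eigenvalues form a sequence $\lambda_1<\lambda_2\le\dots\le\lambda_k\to\infty$, counted with multiplicity. *)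

(* Defs.v *)
From HB Require Import structures.
From mathcomp Require Import all_boot all_order all_algebra.
From mathcomp Require Import all_classical all_reals all_analysis.

Set Implicit Arguments.
Unset Strict Implicit.
Unset Printing Implicit Defensive.

Import Order.TTheory GRing.Theory Num.Theory.
Import numFieldNormedType.Exports.

Local Open Scope classical_set_scope.
Local Open Scope card_scope.
Local Open Scope ring_scope.

Section LogLaplacian.
Context {R : realType}.

Notation mu := (@lebesgue_measure R).

Definition Gamma (s : R) : R :=
  \int[mu]_(t in `]0, +oo[) (t `^ (s - 1) * expR (- t)).

Definition digamma (s : R) : R := derive1 Gamma s / Gamma s.

Definition euler_gamma : R := - derive1 Gamma 1.

Definition rho1 : R := 2 * ln 2 + digamma 2^-1 - euler_gamma.

(* Elements of L^2(R) are represented by functions; functions that agree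
   almost everywhere represent the same element, so every condition below is
   insensitive to changes on a null set.  On the diagonal x = y, also null,
   the quotients evaluate to 0 by the convention 0^-1 = 0. *)

Definition logspace (Om : set R) : set (R -> R) :=
  [set u | [/\ u \in Lfun mu 2%:E,
               {ae mu, forall x, ~ Om x -> u x = 0} &
               (\int[mu]_x \int[mu]_(y in `[(x - 1)%R, (x + 1)%R])
                  (`|u x - u y| ^+ 2 / `|x - y|)%:E < +oo)%E]].

Definition log_form (u v : R -> R) : R :=
  2^-1 * (\int[mu]_x \int[mu]_(y in `[x - 1, x + 1])
            ((u x - u y) * (v x - v y) / `|x - y|))
  - \int[(mu \x mu)%E]_(z in [set z | 1 <= `|z.1 - z.2|])
      (u z.1 * v z.2 / `|z.1 - z.2|)
  + rho1 * \int[mu]_x (u x * v x).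

Definition eigenspace (Om : set R) (l : R) : set (R -> R) :=
  [set u | logspace Om u /\
    forall v, logspace Om v ->
      log_form u v = l * \int[mu]_(x in Om) (u x * v x)].

Definition is_eigenvalue (Om : set R) (l : R) : Prop :=
  exists2 u, eigenspace Om l u & ~ {ae mu, forall x, u x = 0}.

(* The eigenspace, as a subspace of L^2(R), has dimension n: it has a basis of
   n elements, linear relations being understood almost everywhere. *)
Definition has_multiplicity (Om : set R) (l : R) (n : nat) : Prop :=
  exists e : 'I_n -> R -> R,
    [/\ forall j, eigenspace Om l (e j),
        forall c : 'I_n -> R,
          {ae mu, forall x, \sum_(j < n) c j * e j x = 0} ->
          forall j, c j = 0 &
        forall u, eigenspace Om l u ->
          exists c : 'I_n -> R,
            {ae mu, forall x, u x = \sum_(j < n) c j * e j x}].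

(* Multiplicity 0 means that l is not an eigenvalue, so the last clause says
   that the terms of lam are exactly the eigenvalues, each repeated according
   to its multiplicity. *)
Definition eigenvalue_sequence (Om : set R) (lam : nat -> R) : Prop :=
  [/\ lam 0%N < lam 1%N,
      forall i, lam i <= lam i.+1,
      lam i @[i --> \oo] --> +oo &
      forall l, exists2 n, has_multiplicity Om l n &
                           [set i | lam i = l] #= `I_n].

End LogLaplacian.

(* Main.v *)
From HB Require Import structures.
From mathcomp Require Import all_boot all_order all_algebra.
From mathcomp Require Import all_classical all_reals all_analysis.
From mathcomp Require Import measurable_realfun ring lra.
Require Import Defs.
Import Order.TTheory GRing.Theory Num.Theory.
Import numFieldNormedType.Exports.
Local Open Scope classical_set_scope.
Local Open Scope card_scope.
Local Open Scope ring_scope.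
Set Implicit Arguments.
Unset Strict Implicit.
Unset Printing Implicit Defensive.

(** The kernel 1 / |x - y| is homogeneous of degree -1, so dilating an interval
    changes the form of the logarithmic Laplacian only through the two places
    where the distance 1 enters.  Expanding the square over the annulus
    a < |x - y| <= b gives

      (1/2) (double integral of (u x - u y) (v x - v y) / |x - y|)
        = 2 ln (b / a) <u, v> - (double integral of u x v y / |x - y|),

    because the mass of 1 / |t| on a < |t| <= b is 2 ln (b / a)
    ([kernel_expand], [integral_annulus]).  Hence, for functions supported in an
    interval of length s, moving the truncation radius from 1 to s absorbs
    exactly the interaction at distance at least 1:

      log_form u v = (1/2) <D_s u, D_s v> + (rho1 - 2 ln s) <u, v>,

    where D_s u (x, y) = (u x - u y) (1_{|x - y| <= s} / |x - y|)^(1/2) is the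
    function [increment s u] ([log_formE]).  The first term scales like the
    L^2 product, so passing from (-1/2, 1/2) to (-L, L) keeps the
    eigenfunctions, up to dilation, and shifts every eigenvalue by - 2 ln (2 L)
    ([log_form_dil]).  If the eigenvalues of (-1/2, 1/2) are lam_i, then
    L_i = exp (lam_i / 2) / 2 is the half-length for which the i-th one becomes
    0, and lam_i - 2 ln (2 L) = 2 ln (L_i / L).

    It remains to find the spectrum on (-1/2, 1/2), where s = 1.  It is produced
    by successive constrained minimisation of the form on the L^2 sphere
    ([eigenbasis]), for which three facts are needed.

    - Compactness ([log_compactness]).  Write l_k x for the integral of w over
      the dyadic interval of length 2^-k around x.  The difference quotient
      contains, up to a factor 2, the sum over k of 2^k times the indicator
      that x and y share a dyadic interval of length 2^-k, and each summand
      contributes 2 |w|^2 - 2^(k+1) <w, l_k>.  So n scales together give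
      n |w|^2 <= |D_1 w|^2 + sum_(k < n) 2^k <w, l_k> ([dyadic_poincare]):
      a sequence bounded in the form, whose integrals over the finitely many
      relevant dyadic intervals of the first n scales converge, is Cauchy in L^2
      up to an error O(1/n) in the squared norm.

    - The space is infinite dimensional: it contains infinitely many tents with
      disjoint supports ([logspace_tents]).

    - The lowest eigenvalue is simple ([bottom_simple]).  Passing to |u| lowers
      the form strictly if u changes sign, because any two points of the
      interval interact, so minimisers have a sign; the difference of two
      orthonormal nonnegative minimisers would be a minimiser without one. *)

(** * Symmetric bilinear forms on a subspace *)

Definition lin_subspace (R : realType) (V : lmodType R) (D : set V) :=
  D 0 /\ forall a u v, D u -> D v -> D (a *: u + v).

Definition sym_bilinear (R : realType) (V : lmodType R) (D : set V)
    (f : V -> V -> R) :=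
  (forall u v, D u -> D v -> f u v = f v u) /\
  (forall a u v w, D u -> D v -> D w -> f (a *: u + v) w = a * f u w + f v w).

Section Forms.
Context (R : realType) (V : lmodType R) (D : set V) (f : V -> V -> R).
Hypotheses (subD : lin_subspace D) (symf : sym_bilinear D f).

Lemma subspace0 : D 0. Proof. by case: subD. Qed.

Lemma subspaceP a u v : D u -> D v -> D (a *: u + v).
Proof. by case: subD => _; apply. Qed.

Lemma subspaceZ a u : D u -> D (a *: u).
Proof. by move=> Du; rewrite -[_ *: _]addr0; exact: (subspaceP _ Du subspace0). Qed.

Lemma subspaceD u v : D u -> D v -> D (u + v).
Proof. by move=> Du Dv; rewrite -[u]scale1r; exact: subspaceP. Qed.

Lemma subspaceN u : D u -> D (- u).
Proof. by move=> Du; rewrite -scaleN1r; exact: subspaceZ. Qed.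

Lemma subspaceB u v : D u -> D v -> D (u - v).
Proof. by move=> Du Dv; exact: (subspaceD Du (subspaceN Dv)). Qed.

Lemma subspace_sum (I : Type) (s : seq I) (P : pred I) (F : I -> V) :
  (forall i, P i -> D (F i)) -> D (\sum_(i <- s | P i) F i).
Proof.
by move=> DF; apply: (big_ind D) => //; [exact: subspace0|exact: subspaceD].
Qed.

Lemma bilC u v : D u -> D v -> f u v = f v u.
Proof. by case: symf => H _; exact: H. Qed.

Lemma bilPl a u v w : D u -> D v -> D w ->
  f (a *: u + v) w = a * f u w + f v w.
Proof. by case: symf => _; exact. Qed.

Lemma bil0l w : D w -> f 0 w = 0.
Proof.
move=> Dw; have := bilPl 1 subspace0 subspace0 Dw.
by rewrite scale1r addr0 mul1r => /eqP; rewrite -subr_eq0 opprD addrA subrr add0r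
  oppr_eq0 => /eqP.
Qed.

Lemma bilZl a u w : D u -> D w -> f (a *: u) w = a * f u w.
Proof.
by move=> Du Dw; rewrite -[a *: u]addr0 (bilPl a Du subspace0 Dw) bil0l// addr0.
Qed.

Lemma bilDl u v w : D u -> D v -> D w -> f (u + v) w = f u w + f v w.
Proof. by move=> Du Dv Dw; rewrite -[u in u + v]scale1r bilPl// mul1r. Qed.

Lemma bilNl u w : D u -> D w -> f (- u) w = - f u w.
Proof. by move=> Du Dw; rewrite -scaleN1r bilZl// mulN1r. Qed.

Lemma bilBl u v w : D u -> D v -> D w -> f (u - v) w = f u w - f v w.
Proof. by move=> Du Dv Dw; rewrite bilDl// ?bilNl//; exact: subspaceN. Qed.

Lemma bilZr a u w : D u -> D w -> f w (a *: u) = a * f w u.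
Proof. by move=> Du Dw; rewrite bilC ?bilZl ?(bilC Dw)//; exact: subspaceZ. Qed.

Lemma bilDr u v w : D u -> D v -> D w -> f w (u + v) = f w u + f w v.
Proof.
move=> Du Dv Dw; rewrite bilC ?bilDl ?(bilC Dw)//; exact: subspaceD.
Qed.

Lemma bilBr u v w : D u -> D v -> D w -> f w (u - v) = f w u - f w v.
Proof.
move=> Du Dv Dw; rewrite bilC ?bilBl ?(bilC Dw)//; exact: subspaceB.
Qed.

Lemma bil_suml (I : Type) (s : seq I) (F : I -> V) w :
  (forall i, D (F i)) -> D w -> f (\sum_(i <- s) F i) w = \sum_(i <- s) f (F i) w.
Proof.
move=> DF Dw; elim: s => [|i s IH]; first by rewrite !big_nil bil0l.
by rewrite !big_cons bilDl ?IH//; exact: subspace_sum.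
Qed.

Lemma bil_quad t u v : D u -> D v ->
  f (u + t *: v) (u + t *: v) = f u u + 2 * t * f u v + t ^+ 2 * f v v.
Proof.
move=> Du Dv; have Dtv := subspaceZ t Dv.
rewrite bilDl ?bilDr ?bilZl ?bilZr ?(bilC Dv Du)//; try exact: subspaceD.
by ring.
Qed.

End Forms.

(** A function of t that vanishes at 0 and stays nonnegative has no linear term:
    the first-order condition behind both Cauchy-Schwarz and the eigenvalue
    equation of a minimiser. *)
Lemma linear_coef_eq0 (R : realType) (p q : R) :
  (forall t, 0 <= 2 * t * p + t ^+ 2 * q) -> p = 0.
Proof.
move=> H; have q0 : 0 <= q by have := H 1; have := H (-1); lra.
(* The minimiser - p / q, with q + 1 to avoid dividing by 0. *)
have := H (- p / (q + 1)).
have q1 : q + 1 != 0 by rewrite gt_eqF//; lra.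
have -> : 2 * (- p / (q + 1)) * p + (- p / (q + 1)) ^+ 2 * q =
   - (p ^+ 2 * ((q + 2) / (q + 1) ^+ 2)) by field.
rewrite oppr_ge0 pmulr_lle0; last by rewrite divr_gt0// ?exprn_gt0//; lra.
by move=> p2; apply/eqP; rewrite -sqrf_eq0 eq_le p2 sqr_ge0.
Qed.

Lemma cst_cvg_eq (R : realType) (x l : R) :
  (fun _ : nat => x) @ \oo --> l -> x = l.
Proof. by move=> h; have /cvg_lim <- // := h; rewrite lim_cst. Qed.

Section PositiveForm.
Context (R : realType) (V : lmodType R) (D : set V) (b : V -> V -> R).
Hypotheses (subD : lin_subspace D) (symb : sym_bilinear D b).
Hypothesis b_ge0 : forall u, D u -> 0 <= b u u.

Lemma bil_CS u v : D u -> D v -> b u v ^+ 2 <= b u u * b v v.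
Proof.
move=> Du Dv.
have [v0|v0] := eqVneq (b v v) 0.
  suff -> : b u v = 0 by rewrite expr0n/= v0 mulr0.
  rewrite (bilC symb Du Dv).
  apply: (@linear_coef_eq0 _ _ (b u u)) => t.
  have := b_ge0 (subspaceD subD Dv (subspaceZ subD t Du)).
  by rewrite (bil_quad subD symb)// v0 add0r.
have vp : 0 < b v v by rewrite lt_def v0 b_ge0.
have := b_ge0 (subspaceD subD Du (subspaceZ subD (- b u v / b v v) Dv)).
rewrite (bil_quad subD symb)//.
have -> : b u u + 2 * (- b u v / b v v) * b u v +
    (- b u v / b v v) ^+ 2 * b v v = (b u u * b v v - b u v ^+ 2) / b v v by field.
by rewrite pmulr_lge0 ?invr_gt0// subr_ge0.
Qed.

Lemma bil_sub_le u v : D u -> D v -> b (u - v) (u - v) <= 2 * (b u u + b v v).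
Proof.
move=> Du Dv; rewrite -scaleN1r (bil_quad subD symb)//.
have := b_ge0 (subspaceD subD Du (subspaceZ subD 1 Dv)).
rewrite (bil_quad subD symb)//; lra.
Qed.

Lemma cvg_bil0 (x d : nat -> V) (C : R) :
  (forall n, D (x n)) -> (forall n, D (d n)) ->
  (forall n, b (x n) (x n) <= C) ->
  b (d n) (d n) @[n --> \oo] --> (0 : R) ->
  b (x n) (d n) @[n --> \oo] --> (0 : R).
Proof.
move=> Dx Dd xC d0.
have C0 : 0 <= C by exact: le_trans (b_ge0 (Dx 0%N)) (xC 0%N).
apply/cvgr0Pnorm_lt => e e0.
have Ce : 0 < e ^+ 2 / (C + 1) by rewrite divr_gt0 ?exprn_gt0//; lra.
move/cvgr0Pnorm_lt : d0 => /(_ _ Ce); apply: filterS => n.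
rewrite ger0_norm ?b_ge0// ltr_pdivlMr; last by lra.
move=> h; rewrite -(@ltr_pXn2r _ 2)// ?nnegrE ?(ltW e0)//.
rewrite real_normK ?num_real//.
apply: le_lt_trans (bil_CS (Dx n) (Dd n)) _; apply: le_lt_trans h.
by rewrite mulrC ler_wpM2l ?b_ge0//; have := xC n; lra.
Qed.

Lemma cvg_bil_diag (x : nat -> V) w (C : R) : (forall n, D (x n)) -> D w ->
  (forall n, b (x n) (x n) <= C) ->
  b (x n - w) (x n - w) @[n --> \oo] --> (0 : R) ->
  b (x n) (x n) @[n --> \oo] --> b w w.
Proof.
move=> Dx Dw xC d0.
have Dd n : D (x n - w) by exact: subspaceB.
have c0 := cvg_bil0 Dx Dd xC d0.
have -> : (fun n => b (x n) (x n)) =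
    (fun n => b w w + 2 * b (x n) (x n - w) - b (x n - w) (x n - w)).
  apply/funext => n; rewrite !(bilBr subD symb)// !(bilBl subD symb)//.
  by rewrite (bilC symb Dw (Dx n)); ring.
rewrite -[X in _ --> X](_ : b w w + 2 * 0 - 0 = _); last by rewrite mulr0 addr0 subr0.
apply: cvgB => //; apply: cvgD; first exact: cvg_cst.
by apply: cvgM => //; exact: cvg_cst.
Qed.

End PositiveForm.

(** * Spectral theorem for a form with compact sublevel sets *)

Section Spectral.
Context (R : realType) (V : lmodType R) (D : set V) (b E : V -> V -> R).
Hypotheses (subD : lin_subspace D) (symb : sym_bilinear D b)
  (symE : sym_bilinear D E).
Hypothesis b_ge0 : forall u, D u -> 0 <= b u u.
Variable C : R.
Hypothesis E_lower : forall u, D u -> - C * b u u <= E u u.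
(* The compact embedding and the lower semicontinuity of E in one statement. *)
Hypothesis E_compact : forall (u : nat -> V) (M : R),
  (forall n, D (u n)) -> (forall n, b (u n) (u n) <= 1) ->
  (forall n, E (u n) (u n) <= M) ->
  exists phi : nat -> nat, exists w, [/\ {homo phi : i j / (i < j)%N}, D w,
    b (u (phi n) - w) (u (phi n) - w) @[n --> \oo] --> (0 : R) &
    forall l, E (u n) (u n) @[n --> \oo] --> l -> E w w <= l].
Variable psi : nat -> V.
Hypotheses (Dpsi : forall n, D (psi n))
  (psi_ortho : forall i j, i != j -> b (psi i) (psi j) = 0)
  (psi_gt0 : forall i, 0 < b (psi i) (psi i)).

(** A nonzero combination of size s + 1 vectors psi satisfies the size s linear
    constraints; being an orthogonal combination, it has positive norm. *)
Lemma exists_orthogonal (s : seq V) : {in s, forall x, D x} ->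
  exists v, [/\ D v, 0 < b v v & {in s, forall x, b v x = 0}].
Proof.
move=> Ds; set n := size s.
pose M := \matrix_(i < n.+1, j < n) b (psi i) (nth 0 s j).
have : kermx M != 0.
  apply/negP => /eqP /(congr1 (@mxrank _ _ _)); rewrite mxrank_ker mxrank0.
  by apply/eqP; rewrite subn_eq0 -ltnNge ltnS; exact: rank_leq_col.
move=> /rowV0Pn[c /sub_kermxP cM c0].
exists (\sum_(i < n.+1) c 0 i *: psi i).
have Dc (i : 'I_n.+1) : D (c 0 i *: psi i) by exact: subspaceZ.
split; first exact: subspace_sum.
- rewrite (bil_suml subD symb)//; last exact: subspace_sum.
  have H (i : 'I_n.+1) : b (c 0 i *: psi i) (\sum_j c 0 j *: psi j) =
      c 0 i ^+ 2 * b (psi i) (psi i).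
    rewrite (bilC symb)//; last exact: subspace_sum.
    rewrite (bil_suml subD symb)//.
    rewrite (bigD1 i)//= big1 ?addr0 => [|j ji].
      by rewrite (bilZl subD symb)// (bilZr subD symb)// mulrA expr2.
    by rewrite (bilZl subD symb)// (bilZr subD symb)// psi_ortho// !mulr0.
  rewrite (eq_bigr _ (fun i _ => H i)).
  have /rV0Pn [i ci] := c0.
  rewrite (bigD1 i)//= ltr_pwDl//.
    by rewrite mulr_gt0// exprn_even_gt0.
  by apply: sumr_ge0 => j _; rewrite mulr_ge0 ?sqr_ge0// ltW.
- move=> x xs; have /(nthP 0) [j js <-] := xs.
  rewrite (bil_suml subD symb)//; last by apply: Ds; exact: mem_nth.
  have /matrixP/(_ 0 (Ordinal js)) := cM; rewrite !mxE; apply: etrans.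
  apply: eq_bigr => i _; rewrite mxE (bilZl subD symb)//.
  by apply: Ds; exact: mem_nth.
Qed.

(** The direct method: the sublevels of E being compact, a minimising sequence
    converges in norm, so that its limit keeps the norm and the constraints. *)
Lemma constrained_minimizer (s : seq V) : {in s, forall x, D x} ->
  exists u, [/\ D u, b u u = 1, {in s, forall x, b u x = 0} &
    forall v, D v -> {in s, forall x, b v x = 0} -> E u u * b v v <= E v v].
Proof.
move=> Ds.
pose S := [set r | exists v, [/\ D v, b v v = 1,
  {in s, forall x, b v x = 0} & r = E v v]].
have normalize v : D v -> 0 < b v v -> {in s, forall x, b v x = 0} ->
    S (E v v / b v v).
  move=> Dv v0 vs; set a := (Num.sqrt (b v v))^-1.
  have aE : a * a = (b v v)^-1.
    by rewrite -expr2 exprVn sqr_sqrtr// ltW.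
  have Dav := subspaceZ subD a Dv.
  exists (a *: v); split => //.
  - by rewrite (bilZl subD symb)// (bilZr subD symb)// mulrA aE mulVf// gt_eqF.
  - by move=> x xs; rewrite (bilZl subD symb)// ?vs ?mulr0//; exact: Ds.
  - by rewrite (bilZl subD symE)// (bilZr subD symE)// mulrA aE mulrC.
have S0 : S !=set0.
  have [v [Dv v0 vs]] := exists_orthogonal Ds.
  by exists (E v v / b v v); exact: normalize.
have Slb : lbound S (- C).
  by move=> _ [v [Dv v1 _ ->]]; have := E_lower Dv; rewrite v1 mulr1.
have Sinf : has_inf S by split => //; exists (- C).
set m := inf S.
have /choice [u uP] : forall n : nat, exists v, [/\ D v, b v v = 1,
   {in s, forall x, b v x = 0} & E v v < m + n.+1%:R^-1].
  move=> n; have e0 : 0 < n.+1%:R^-1 :> R by rewrite invr_gt0 ltr0n.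
  have [_ [v [Dv v1 vs ->]] vm] := inf_adherent e0 Sinf.
  by exists v.
have Du n : D (u n) by have [] := uP n.
have u1 n : b (u n) (u n) = 1 by have [] := uP n.
have mle r : S r -> m <= r by move=> Sr; apply: ge_inf => //; exists (- C).
have mEu n : m <= E (u n) (u n).
  by have [? ? ? _] := uP n; apply: mle; exists (u n).
have EuM n : E (u n) (u n) <= m + 1.
  have [_ _ _ /ltW h] := uP n; apply: (le_trans h).
  by rewrite lerD2l invf_le1 ?ltr0n// ler1n.
have bu n : b (u n) (u n) <= 1 by rewrite u1.
have [phi [w [phiS Dw cvgw Ew]]] := E_compact Du bu EuM.
have wm : E w w <= m.
  apply: Ew; apply: (@squeeze_cvgr _ _ _ _ (cst m) (fun n => m + n.+1%:R^-1)).
  - near=> n; rewrite mEu/=.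
    by have [_ _ _ /ltW] := uP n.
  - exact: cvg_cst.
  - rewrite -[X in _ --> X]addr0; apply: cvgD; first exact: cvg_cst.
    by have := @cvg_harmonic R; apply: cvg_trans.
have Dd n : D (u (phi n) - w) by exact: subspaceB.
have cvg_b x : (forall n, D (x n)) -> (forall n, b (x n) (x n) <= 1) ->
    b (x n) (u (phi n) - w) @[n --> \oo] --> (0 : R).
  by move=> Dx bx; apply: (cvg_bil0 subD symb b_ge0 Dx Dd bx cvgw).
have w1 : b w w = 1.
  have := cvg_bil_diag subD symb b_ge0 (fun n => Du (phi n)) Dw (fun n => bu (phi n)) cvgw.
  have -> : (fun n => b (u (phi n)) (u (phi n))) = (fun=> 1) by apply/funext => n.
  by move=> /cst_cvg_eq.
have ws : {in s, forall x, b w x = 0}.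
  move=> x xs; have Dx := Ds _ xs.
  (* A multiple of x in the unit ball, as the convergence above requires. *)
  pose y := (Num.sqrt (b x x + 1))^-1 *: x.
  have Dy : D y by exact: subspaceZ.
  have bx := b_ge0 Dx.
  have sq : 0 < Num.sqrt (b x x + 1) by rewrite sqrtr_gt0; lra.
  have y1 : b y y <= 1.
    rewrite (bilZl subD symb)// (bilZr subD symb)// mulrA -invfM -expr2.
    by rewrite sqr_sqrtr ?addr_ge0// mulrC ler_pdivrMr; lra.
  have := cvg_b (fun _ => y) (fun _ => Dy) (fun _ => y1).
  have -> : (fun n => b y (u (phi n) - w)) = (fun _ => - b w y).
    apply/funext => n; rewrite (bilC symb Dy (Dd n)) (bilBl subD symb)//.
    rewrite (bilZr subD symb _ Dx (Du _)).
    by have [_ _ /(_ _ xs) -> _] := uP (phi n); rewrite mulr0 sub0r.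
  move=> /cst_cvg_eq.
  rewrite (bilZr subD symb)// => /eqP; rewrite oppr_eq0 mulf_eq0 invr_eq0 gt_eqF//=.
  by move/eqP.
have Ewm : E w w = m by apply/eqP; rewrite eq_le wm mle//; exists w.
exists w; split => // v Dv vs; rewrite Ewm.
have := b_ge0 Dv; rewrite le_eqVlt => /predU1P[v0|v0].
  by have := E_lower Dv; rewrite -v0 !mulr0.
by rewrite -ler_pdivlMr//; apply: mle; exact: normalize.
Unshelve. all: by end_near. Qed.

Lemma minimizing_sequence : exists e : nat -> V, forall n,
  [/\ D (e n), b (e n) (e n) = 1, forall i, (i < n)%N -> b (e n) (e i) = 0 &
    forall v, D v -> (forall i, (i < n)%N -> b v (e i) = 0) ->
      E (e n) (e n) * b v v <= E v v].
Proof.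
have /choice [next nextP] : forall s : seq V, exists u, {in s, forall x, D x} ->
    [/\ D u, b u u = 1, {in s, forall x, b u x = 0} &
      forall v, D v -> {in s, forall x, b v x = 0} -> E u u * b v v <= E v v].
  move=> s; have [Ds|nDs] := pselect {in s, forall x, D x}.
    by have [u] := constrained_minimizer Ds; exists u.
  by exists 0.
pose S n := iter n (fun s => rcons s (next s)) [::].
pose e n := next (S n).
have SE n : S n = mkseq e n by elim: n => [//|n IH]; rewrite mkseqS -IH.
have DS n : {in S n, forall x, D x}.
  elim: n => [//|n IH] x; rewrite /S iterS -/(S n) mem_rcons inE.
  by case/predU1P => [->|/IH//]; have [] := nextP _ IH.
exists e => n; have [De e1 eS emin] := nextP _ (DS n); split => //.
- by move=> i ni; apply: eS; rewrite SE; apply: map_f; rewrite mem_iota.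
- move=> v Dv vS; apply: emin => // x; rewrite SE => /mapP[i].
  by rewrite mem_iota add0n => /vS vi ->.
Qed.

(** Each minimiser satisfies the eigenvalue equation against the vectors
    orthogonal to the previous ones by the first-order condition, and against
    the previous ones by induction and symmetry.  The eigenvalues are unbounded
    since an orthonormal sequence has no convergent subsequence. *)
Theorem eigenbasis : exists (e : nat -> V) (lam : nat -> R),
  [/\ forall n, D (e n), forall i j, b (e i) (e j) = (i == j)%:R,
      forall n v, D v -> E (e n) v = lam n * b (e n) v,
      lam n @[n --> \oo] --> +oo &
      forall n, lam n <= lam n.+1 /\
        forall v, D v -> (forall i, (i < n)%N -> b v (e i) = 0) ->
          lam n * b v v <= E v v].
Proof.
have [e eP] := minimizing_sequence; pose lam n := E (e n) (e n).
have De n : D (e n) by have [] := eP n.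
have e1 n : b (e n) (e n) = 1 by have [] := eP n.
have elt n i : (i < n)%N -> b (e n) (e i) = 0 by have [_ _ + _] := eP n; apply.
have emin n v : D v -> (forall i, (i < n)%N -> b v (e i) = 0) ->
    lam n * b v v <= E v v by have [_ _ _] := eP n; apply.
have eO i j : b (e i) (e j) = (i == j)%:R.
  have [->|] := eqVneq i j; first by rewrite e1.
  by rewrite neq_lt => /orP[|] ij; [rewrite (bilC symb)//|]; rewrite elt.
have eE n v : D v -> E (e n) v = lam n * b (e n) v.
  elim/ltn_ind: n v => n IH v Dv.
  have restricted w : D w -> (forall i, (i < n)%N -> b w (e i) = 0) ->
      E (e n) w = lam n * b (e n) w.
    move=> Dw wi; apply/eqP; rewrite -subr_eq0; apply/eqP.
    apply: (@linear_coef_eq0 _ _ (E w w - lam n * b w w)) => t.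
    have Dt : D (e n + t *: w) by apply: subspaceD => //; exact: subspaceZ.
    have := emin n _ Dt; rewrite (bil_quad subD symb)// (bil_quad subD symE)//.
    rewrite e1 -/(lam n) => H; rewrite -subr_ge0 in H.
    suff : forall i, (i < n)%N -> b (e n + t *: w) (e i) = 0 by move=> /H; lra.
    move=> i ni; rewrite (bilDl symb)//; last exact: subspaceZ.
    by rewrite (bilZl subD symb)// wi// elt// mulr0 addr0.
  pose p := \sum_(i < n) b v (e i) *: e i.
  have Dpi (i : 'I_n) : D (b v (e i) *: e i) by exact: subspaceZ.
  have Dp : D p by exact: subspace_sum.
  have Ep : E (e n) p = 0.
    rewrite (bilC symE)// (bil_suml subD symE)// big1// => i _.
    by rewrite (bilZl subD symE)// IH// eO ltn_eqF// !mulr0.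
  have bp : b (e n) p = 0.
    rewrite (bilC symb)// (bil_suml subD symb)// big1// => i _.
    by rewrite (bilZl subD symb)// eO ltn_eqF// !mulr0.
  have Dvp : D (v - p) by exact: subspaceB.
  have := restricted (v - p) Dvp.
  rewrite (bilBr subD symE)// (bilBr subD symb)// Ep bp !subr0; apply.
  move=> i ni; rewrite (bilBl subD symb)// (bil_suml subD symb)//.
  rewrite (bigD1 (Ordinal ni))//= big1 => [|j ji].
    by rewrite (bilZl subD symb)// e1 mulr1 addr0 subrr.
  rewrite (bilZl subD symb)// eO; case: eqP => [ij|]; last by rewrite mulr0.
  by case/eqP: ji; exact: val_inj.
have lamS n : lam n <= lam n.+1.
  by have := emin n _ (De n.+1); rewrite e1 mulr1; apply => i ni; exact/elt/ltnW.
have lamle m n : (m <= n)%N -> lam m <= lam n.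
  by move: m n; apply/nondecreasing_seqP.
exists e, lam; split => //; last by move=> n; split => // v; exact: emin.
apply/cvgryPge => A; apply: contrapT => notA.
have lamA n : lam n <= A.
  rewrite leNgt; apply/negP => An; apply: notA; exists n => // m /= nm.
  by rewrite (le_trans (ltW An))// lamle.
have be n : b (e n) (e n) <= 1 by rewrite e1.
have [phi [w [phiS Dw cvgw _]]] := E_compact De be lamA.
(* Consecutive terms are at squared distance 2 from each other, yet each comes
   within squared distance 1 / 2 of the limit w. *)
have h0 : 0 < 2^-1 :> R by [].
move/cvgr0Pnorm_lt : cvgw => /(_ _ h0) [N _ HN].
have Dd n : D (e (phi n) - w) by exact: subspaceB.
have d2 n : (N <= n)%N -> b (e (phi n) - w) (e (phi n) - w) < 2^-1.
  by move=> /HN /=; rewrite ger0_norm// b_ge0.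
have h1 := d2 _ (leqnn N); have h2 := d2 _ (leqnSn N).
have := b_ge0 (subspaceD subD (Dd N) (subspaceZ subD 1 (Dd N.+1))).
rewrite (bil_quad subD symb)//.
have := bil_quad subD symb (-1) (Dd N) (Dd N.+1).
rewrite scaleN1r opprB addrA subrK.
suff -> : b (e (phi N) - e (phi N.+1)) (e (phi N) - e (phi N.+1)) = 2 by lra.
rewrite (bilBl subD symb (De _) (De _) (subspaceB subD (De _) (De _))).
rewrite !(bilBr subD symb)// !eO !eqxx.
rewrite (ltn_eqF (phiS _ _ (ltnSn N))) (gtn_eqF (phiS _ _ (ltnSn N)))/=; ring.
Qed.

End Spectral.

Section Multiplicity.
Context (R : realType) (V : lmodType R) (D : set V) (b E : V -> V -> R).
Hypotheses (subD : lin_subspace D) (symb : sym_bilinear D b)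
  (symE : sym_bilinear D E).
Hypothesis b_ge0 : forall u, D u -> 0 <= b u u.
Variables (e : nat -> V) (lam : nat -> R).
Hypotheses (De : forall n, D (e n))
  (eO : forall i j, b (e i) (e j) = (i == j)%:R)
  (eE : forall n v, D v -> E (e n) v = lam n * b (e n) v)
  (lamy : lam n @[n --> \oo] --> +oo)
  (emin : forall n v, D v -> (forall i, (i < n)%N -> b v (e i) = 0) ->
          lam n * b v v <= E v v).

Definition eigenvector (l : R) (u : V) :=
  D u /\ forall v, D v -> E u v = l * b u v.

(** What an eigenvector u for l leaves after projection on the e_i with lam i = l
    is an eigenvector orthogonal to all e_i; its quotient E / b would exceed
    every lam i, so it is null. *)
Lemma eigenspace_basis (l : R) : exists n (f : 'I_n -> V),
  [/\ forall j, eigenvector l (f j), forall i j, b (f i) (f j) = (i == j)%:R,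
      [set i | lam i = l] #= `I_n &
      forall u, eigenvector l u ->
        b (u - \sum_j b u (f j) *: f j) (u - \sum_j b u (f j) *: f j) = 0].
Proof.
have [N _ lamN] := (cvgryPgt _).1 lamy l.
pose s := [seq i <- iota 0 N | lam i == l]; pose n := size s.
have sE i : (i \in s) = (lam i == l).
  rewrite mem_filter mem_iota add0n /=; apply: andb_idr => /eqP il.
  by rewrite ltnNge; apply/negP => /lamN/=; rewrite il ltxx.
have lams i : (i < n)%N -> lam (nth 0%N s i) = l.
  by move=> ni; apply/eqP; rewrite -sE mem_nth.
have us : uniq s by rewrite filter_uniq// iota_uniq.
pose f (j : 'I_n) := e (nth 0%N s j).
have Df j : D (f j) by exact: De.
have fE j v : D v -> E (f j) v = l * b (f j) v by move=> Dv; rewrite eE// lams.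
exists n, f; split => //.
- by move=> j; split => // v; exact: fE.
- by move=> i j; rewrite eO nth_uniq.
- have -> : [set i | lam i = l] = [set nth 0%N s i | i in `I_n].
    apply/seteqP; split => [i /= il|_ [i /= ni <-]]; last exact: lams.
    have /(nthP 0%N)[j jn <-] : i \in s by rewrite sE il.
    by exists j.
  apply: inj_card_eq => i j /[!inE] /= ni nj /eqP.
  by rewrite nth_uniq// => /eqP.
- move=> u [Du uE].
  set p := \sum_j _; pose w := u - p.
  have Dbf (j : 'I_n) : D (b u (f j) *: f j) by exact: subspaceZ.
  have Dp : D p by exact: subspace_sum.
  have Dw : D w by exact: subspaceB.
  have wE v : D v -> E w v = l * b w v.
    move=> Dv; rewrite (bilBl subD symE)// (bilBl subD symb)// uE//.
    rewrite (bil_suml subD symE)// (bil_suml subD symb)// mulrBr; congr (_ - _).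
    rewrite mulr_sumr; apply: eq_bigr => j _.
    by rewrite (bilZl subD symE)// (bilZl subD symb)// fE// mulrCA.
  have we i : b w (e i) = 0.
    have [il|il] := eqVneq (lam i) l; last first.
      apply/eqP; move: (wE _ (De i)); rewrite (bilC symE)// eE//.
      rewrite (bilC symb (De i) Dw) => /eqP.
      by rewrite -subr_eq0 -mulrBl mulf_eq0 subr_eq0 (negPf il).
    have /(nthP 0%N)[j jn ji] : i \in s by rewrite sE il.
    rewrite (bilBl subD symb)// (bil_suml subD symb)//.
    rewrite (bigD1 (Ordinal jn))//= big1 => [|k kj].
      by rewrite (bilZl subD symb)// /f /= ji eO eqxx mulr1 addr0 subrr.
    rewrite (bilZl subD symb)// eO -ji nth_uniq//.
    by rewrite (_ : (k == j :> nat) = false) ?mulr0//; apply/negbTE.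
  apply/eqP; rewrite eq_le b_ge0// andbT leNgt; apply/negP => w0.
  have := emin (n := N) Dw (fun i _ => we i); rewrite wE// ler_pM2r//.
  by rewrite leNgt; have /= -> := lamN N (leqnn N).
Qed.

End Multiplicity.

(** * Square integrable functions *)

Section SquareIntegrable.
Context d (T : measurableType d) (R : realType).
Variable m : {measure set T -> \bar R}.

Definition L2 : set (T -> R) := [set f | f \in Lfun m 2%:E].

Definition ip (f g : T -> R) : R := \int[m]_x (f x * g x).

Lemma L2_measurable f : L2 f -> measurable_fun setT f.
Proof. by move=> /sub_Lfun_mfun; rewrite inE. Qed.

Lemma L2P f : L2 f <->
  measurable_fun setT f /\ (\int[m]_x (f x ^+ 2)%:E < +oo)%E.
Proof.
have E2 : (\int[m]_x (`|(f x)%:E| `^ 2)%E = \int[m]_x (f x ^+ 2)%:E)%E.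
  apply: eq_integral => x _; rewrite abse_EFin poweR_EFin powR_mulrn//.
  by rewrite -normrX ger0_norm// sqr_ge0.
split=> [Lf|[mf fi]].
  split; first exact: L2_measurable.
  have /integrableP[_] := Lfun2_integrable_sqr Lf.
  by under eq_integral do rewrite /= ger0_norm ?sqr_ge0//.
rewrite /L2 /= inE; apply/andP; split; rewrite inE//=.
by rewrite /finite_norm unlock/= poweR_lty// E2.
Qed.

Lemma L2_int f : L2 f -> (\int[m]_x (f x ^+ 2)%:E < +oo)%E.
Proof. by move=> /L2P[]. Qed.

Lemma L2_integrableM f g : L2 f -> L2 g ->
  m.-integrable setT (EFin \o (fun x => f x * g x)).
Proof. by move=> Lf Lg; apply/Lfun1_integrable; exact: Lfun2_mul_Lfun1. Qed.

Lemma L2_subspace : lin_subspace L2.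
Proof.
have [h0 hD] := Lfun_submod_closed m (lee1n 2).
by split => [|a u v Lu Lv]; [exact: h0|exact: hD].
Qed.

Lemma L2_le (f g : T -> R) : measurable_fun setT g -> (forall x, `|g x| <= `|f x|) ->
  L2 f -> L2 g.
Proof.
move=> mg gf /L2P[mf fi]; apply/L2P; split => //; apply: le_lt_trans fi.
apply: ge0_le_integral => //.
- by move=> x _; rewrite lee_fin sqr_ge0.
- exact/measurable_EFinP/measurable_funX.
- exact/measurable_EFinP/measurable_funX.
- move=> x _; rewrite lee_fin -[_ ^+ 2]real_normK ?num_real//.
  by rewrite -[leRHS]real_normK ?num_real// ler_sqr ?nnegrE.
Qed.

Lemma ip_sym_bilinear : sym_bilinear L2 ip.
Proof.
split=> [u v _ _|a u v w Lu Lv Lw]; first by congr Rintegral; apply/funext => x; rewrite mulrC.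
rewrite /ip -RintegralZl//; last exact: L2_integrableM.
rewrite -RintegralD//; last 2 first.
- have := integrableZl measurableT a (L2_integrableM Lu Lw).
  by apply: eq_integrable => // x _ /=.
- exact: L2_integrableM.
by congr Rintegral; apply/funext => x; rewrite mulrDl mulrA.
Qed.

Lemma ip_ge0 u : L2 u -> 0 <= ip u u.
Proof. by move=> _; apply: Rintegral_ge0 => x _; rewrite -expr2 sqr_ge0. Qed.

Lemma ipE u : L2 u -> (ip u u)%:E = (\int[m]_x (u x ^+ 2)%:E)%E.
Proof.
move=> Lu; rewrite /ip /Rintegral fineK; last exact/integrable_fin_num/L2_integrableM.
by apply: eq_integral => x _; rewrite expr2.
Qed.

Lemma Rintegral_eq0_ae (f : T -> R) : m.-integrable setT (EFin \o f) ->
  (forall x, 0 <= f x) -> \int[m]_x f x = 0 -> {ae m, forall x, f x = 0}.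
Proof.
move=> intf f0 i0; have mf := measurable_int _ intf.
have : (\int[m]_x `|(EFin \o f) x| = 0)%E.
  under eq_integral do rewrite gee0_abs ?lee_fin//.
  by rewrite -[LHS]fineK; [rewrite -/(Rintegral m setT f) i0|exact: integrable_fin_num].
move=> /(ae_eq_integral_abs _ measurableT mf).
by apply: filterS => x /(_ I) [].
Qed.

Lemma ip_eq0 u : L2 u -> ip u u = 0 -> {ae m, forall x, u x = 0}.
Proof.
move=> Lu u0.
have h : {ae m, forall x, u x * u x = 0}.
  by apply: Rintegral_eq0_ae => //; [exact: L2_integrableM|move=> x; rewrite -expr2 sqr_ge0].
by apply: filterS h => x /eqP; rewrite -expr2 sqrf_eq0 => /eqP.
Qed.

Lemma eq_ae_Rintegral (f g : T -> R) : measurable_fun setT f ->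
  measurable_fun setT g -> {ae m, forall x, f x = g x} ->
  \int[m]_x f x = \int[m]_x g x.
Proof.
move=> mf mg fg; rewrite /Rintegral; congr fine; apply: ae_eq_integral => //.
- exact/measurable_EFinP.
- exact/measurable_EFinP.
- by apply: filterS fg => x /= -> _.
Qed.

Lemma eq_ae_ip u u' v : L2 u -> L2 u' -> L2 v ->
  {ae m, forall x, u x = u' x} -> ip u v = ip u' v.
Proof.
move=> /L2_measurable mu /L2_measurable mu' /L2_measurable mv uu'.
apply: eq_ae_Rintegral; [exact: measurable_funM..|].
by apply: filterS uu' => x ->.
Qed.

(** Fatou in the form used for lower semicontinuity: only upper bounds of the
    integrals have to converge. *)
Lemma fatou_le (f : nat -> T -> R) (g : T -> R) (c : R ^nat) (l : R) :
  (forall n, measurable_fun setT (f n)) -> measurable_fun setT g ->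
  (forall n x, 0 <= f n x) -> (forall x, 0 <= g x) ->
  {ae m, forall x, f n x @[n --> \oo] --> g x} ->
  (forall n, \int[m]_x (f n x)%:E <= (c n)%:E)%E -> c n @[n --> \oo] --> l ->
  (\int[m]_x (g x)%:E <= l%:E)%E.
Proof.
move=> mf mg f0 g0 fg fc cl.
have mfE n : measurable_fun setT (EFin \o f n) by exact/measurable_EFinP.
have f0E n x : setT x -> (0 <= (EFin \o f n) x)%E by rewrite lee_fin.
have fatE := fatou m measurableT mfE f0E.
have einf_ge0 (u : (\bar R)^nat) : (forall n, 0 <= u n)%E -> (0 <= limn_einf u)%E.
  move=> u0; rewrite limn_einf_lim; apply: lime_ge; first exact: is_cvg_einfs.
  by apply: nearW => n; apply: le_ereal_inf_tmp => _ [k /= _ <-].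
apply: (@le_trans _ _ (\int[m]_x limn_einf ((fun n => (EFin \o f n) x)))%E).
  apply: ae_ge0_le_integral => //.
  - by move=> x _; rewrite lee_fin.
  - exact/measurable_EFinP.
  - by move=> x _; apply: einf_ge0 => n; exact: f0E.
  - rewrite /limn_einf; apply: measurableT_comp => //.
    by apply: measurable_fun_limn_esup => n; apply: measurableT_comp.
  - apply: filterS fg => x fgx _.
    have h : (EFin \o f n) x @[n --> \oo] --> (g x)%:E.
      by apply: cvg_EFin => //; exact: nearW.
    by have [-> _] := cvg_limn_einf_sup h.
apply: (le_trans fatE).
have h : (c n)%:E @[n --> \oo] --> l%:E by apply: cvg_EFin => //; exact: nearW.
have [<- _] := cvg_limn_einf_sup h.
rewrite !limn_einf_lim; apply: lee_lim; [exact: is_cvg_einfs..|].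
apply: nearW => n; apply: le_ereal_inf_tmp => _ [k /= nk <-].
by apply: le_trans (fc k); apply: ereal_inf_lbound; exists k.
Qed.

End SquareIntegrable.

(** * Almost everywhere limits of rapidly Cauchy sequences *)

Section RieszFischer.
Context d (T : measurableType d) (R : realType).
Variable m : {measure set T -> \bar R}.

Lemma geometric_nneseries_lty (a : (\bar R)^nat) :
  (forall n, 0 <= a n)%E -> (forall n, a n <= (2^-1 ^+ n)%:E)%E ->
  (\sum_(0 <= n <oo) a n < +oo)%E.
Proof.
move=> a0 ale; apply: (@le_lt_trans _ _ 2%:E); last exact: ltry.
apply: lime_le; first by apply: is_cvg_nneseries => n _ _; exact: a0.
apply: nearW => n; apply: (@le_trans _ _ (\sum_(0 <= k < n) (2^-1 ^+ k)%:E)%E).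
  by apply: lee_sum => k _; exact: ale.
rewrite sumEFin lee_fin.
have h0 : 0 < 2^-1 :> R by [].
have h1 : `|2^-1 : R| < 1 by rewrite ger0_norm ?invr_ge0// invf_lt1// ltr1n.
have := geometric_le_lim n ler01 h0 h1; rewrite /series/=.
under eq_bigr do rewrite mul1r.
by move/le_trans; apply; rewrite div1r [X in X^-1](_ : _ = 2^-1) ?invrK//; lra.
Qed.

(** Weighted by 4 ^ n, the squares of v n.+1 - v n still have a finite integral,
    hence a finite sum almost everywhere; at such points v n.+1 - v n is O(2 ^- n)
    and v converges.  The rate 8 ^- n leaves room for these weights. *)
Lemma fast_cauchy_ae_cvg (v : nat -> T -> R) : (forall n, L2 m (v n)) ->
  (forall n, ip m (v n.+1 - v n) (v n.+1 - v n) <= 8^-1 ^+ n) ->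
  {ae m, forall x, cvgn (v ^~ x)}.
Proof.
move=> Lv dv; pose dn n := v n.+1 - v n.
have Ld n : L2 m (dn n) by exact: (subspaceB (L2_subspace m)).
pose F n x := (4 ^+ n * dn n x ^+ 2)%:E.
have mF n : measurable_fun setT (F n).
  apply/measurable_EFinP; apply: measurable_funM => //.
  by apply: measurable_funX; exact: L2_measurable (Ld n).
have F0 n x : setT x -> (0 <= F n x)%E.
  by move=> _; rewrite lee_fin mulr_ge0 ?sqr_ge0 ?exprn_ge0.
have sF0 x : (0 <= \sum_(0 <= n <oo) F n x)%E.
  by apply: nneseries_ge0 => n _ _; exact: F0.
have iF n : (\int[m]_x F n x <= (2^-1 ^+ n)%:E)%E.
  rewrite /F; under eq_integral do rewrite EFinM.
  rewrite ge0_integralZl//; last 2 first.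
  - by apply/measurable_EFinP/measurable_funX; exact: L2_measurable (Ld n).
  - by move=> x _; rewrite lee_fin sqr_ge0.
  rewrite -ipE// -EFinM lee_fin (le_trans (ler_wpM2l _ (dv n))) ?exprn_ge0//.
  by rewrite -exprMn (_ : 4 * 8^-1 = 2^-1 :> R)//; lra.
have isF : m.-integrable setT (fun x => \sum_(0 <= n <oo) F n x)%E.
  apply/integrableP; split.
    by apply: ge0_emeasurable_sum => // n x _ _; exact: F0.
  under eq_integral do rewrite gee0_abs//.
  rewrite integral_nneseries//; apply: geometric_nneseries_lty => // n.
  by apply: integral_ge0 => x _; exact: F0.
have := integrable_ae measurableT isF; apply: filterS => x /(_ I) fx.
pose C := fine (\sum_(0 <= n <oo) F n x)%E.
have dC n : `|dn n x| <= Num.sqrt C * 2^-1 ^+ n.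
  have FC : 4 ^+ n * dn n x ^+ 2 <= C.
    rewrite -lee_fin fineK//; apply: le_trans (nneseries_lim_ge n.+1 _); last first.
      by move=> k _ _; exact: F0.
    rewrite big_nat_recr//= leeDr//; apply: sume_ge0 => k _; exact: F0.
  have C0 : 0 <= C by exact: fine_ge0.
  rewrite -(@ler_pXn2r _ 2)// ?nnegrE ?mulr_ge0 ?sqrtr_ge0 ?exprn_ge0 ?invr_ge0//.
  rewrite exprMn sqr_sqrtr// real_normK ?num_real// -exprM mulnC exprM.
  rewrite exprVn -ler_pdivrMr; last by rewrite exprn_gt0 ?invr_gt0 ?exprn_gt0.
  rewrite exprVn invrK mulrC (_ : 2 ^+ 2 = 4 :> R)//; ring.
have cd : cvgn (series (fun n => dn n x)).
  apply: normed_cvg; apply: (@series_le_cvg _ _ (geometric (Num.sqrt C) 2^-1)) => //.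
  - by move=> n; exact: normr_ge0.
  - by move=> n; apply: geometric_ge0; rewrite ?sqrtr_ge0 ?invr_ge0.
  - apply: is_cvg_geometric_series.
    by rewrite ger0_norm ?invr_ge0// invf_lt1// ltr1n.
have -> : v ^~ x = (fun n => v 0%N x + series (fun n => dn n x) n).
  apply/funext => n; rewrite /series/=.
  elim: n => [|n IH]; first by rewrite big_nil addr0.
  by rewrite big_nat_recr//= addrA -IH /dn -[(_ - _) x]/(v n.+1 x - v n x) addrC subrK.
by apply: is_cvgD => //; exact: is_cvg_cst.
Qed.

(** The limit is taken as a limit superior, which is measurable without any
    convergence, and Fatou turns the Cauchy estimate into one against it. *)
Lemma fast_cauchy_L2_limit (v : nat -> T -> R) : (forall n, L2 m (v n)) ->
  (forall n k, (k <= n)%N -> ip m (v n - v k) (v n - v k) <= 8^-1 ^+ k) ->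
  exists w, [/\ L2 m w, {ae m, forall x, v n x @[n --> \oo] --> w x} &
    ip m (v n - w) (v n - w) @[n --> \oo] --> (0 : R)].
Proof.
move=> Lv vC; have mv n := L2_measurable (Lv n).
pose w x := fine (limn_esup (fun n => (v n x)%:E)).
have mw : measurable_fun setT w.
  apply: (measurableT_comp (fine_measurable measurableT)).
  by apply: measurable_fun_limn_esup => n; exact/measurable_EFinP.
have vw : {ae m, forall x, v n x @[n --> \oo] --> w x}.
  have := fast_cauchy_ae_cvg Lv (fun n => vC _ _ (leqnSn n)).
  apply: filterS => x cvx.
  have h : (v n x)%:E @[n --> \oo] --> (limn (v ^~ x))%:E.
    by apply: cvg_EFin => //; exact: nearW.
  by rewrite /w; have [_ ->] := cvg_limn_einf_sup h.
have bound k : (\int[m]_x ((v k x - w x) ^+ 2)%:E <= (8^-1 ^+ k)%:E)%E.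
  apply: (@fatou_le _ _ _ _ (fun n x => (v (n + k)%N x - v k x) ^+ 2) _
    (fun=> 8^-1 ^+ k)) => //.
  - by move=> n; apply: measurable_funX; exact: measurable_funB.
  - by apply: measurable_funX; exact: measurable_funB.
  - by move=> n x; exact: sqr_ge0.
  - by move=> x; exact: sqr_ge0.
  - apply: filterS vw => x vwx.
    have h : v (n + k)%N x - v k x @[n --> \oo] --> w x - v k x.
      by apply: cvgB; [rewrite (cvg_shiftn k (v ^~ x))|exact: cvg_cst].
    by rewrite -sqrrN opprB; exact: (cvgM h h).
  - move=> n; have := vC (n + k)%N k (leq_addl _ _).
    by rewrite -lee_fin ipE//; exact: (subspaceB (L2_subspace m)).
  - exact: cvg_cst.
have Lvw k : L2 m (v k - w).
  apply/L2P; split; first by apply: measurable_funB.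
  exact: le_lt_trans (bound k) (ltry _).
exists w; split => //.
  have -> : w = v 0%N - (v 0%N - w) by rewrite opprB addrC subrK.
  exact: (subspaceB (L2_subspace m)).
apply: (@squeeze_cvgr _ _ _ _ (fun=> 0) (fun n => 8^-1 ^+ n)).
- by apply: nearW => n; rewrite ip_ge0//= -lee_fin ipE// bound.
- exact: cvg_cst.
- by apply: cvg_expr; rewrite ger0_norm ?invr_ge0// invf_lt1// ltr1n.
Qed.

End RieszFischer.

(** * Symmetric kernels of constant mass *)

Section SymmetricKernel.
Context (R : realType).
Notation mu := (@lebesgue_measure R).
Notation mu2 := (mu \x mu)%E.

Lemma integral_swap (f : R * R -> R) : mu2.-integrable setT (EFin \o f) ->
  \int[mu2]_z f z = \int[mu2]_z f (z.2, z.1).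
Proof.
move=> intf; have mf := measurable_int _ intf.
have mfs : measurable_fun [set: R * R] (EFin \o (fun z => f (z.2, z.1))).
  apply: (measurableT_comp mf); apply: measurable_fun_pair => //.
have intfs : mu2.-integrable setT (EFin \o (fun z => f (z.2, z.1))).
  by apply/integrable12ltyP => //=; exact: ((integrable21ltyP _ _ mf).1 intf).
congr fine.
have /= <- := integral21_prod_meas1 intf.
by have /= <- := integral12_prod_meas1 intfs.
Qed.

Section Kernel.
Variables (K : R * R -> R) (c : R).
Hypotheses (mK : measurable_fun setT K) (K0 : forall z, 0 <= K z)
  (KC : forall z, K (z.2, z.1) = K z)
  (Kc : forall x, (\int[mu]_y (K (x, y))%:E = c%:E)%E).

Lemma kernel_fst (f : R -> R) : mu.-integrable setT (EFin \o f) ->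
  mu2.-integrable setT (EFin \o (fun z => f z.1 * K z)) /\
  \int[mu2]_z (f z.1 * K z) = c * \int[mu]_x f x.
Proof.
move=> intf; have mf : measurable_fun setT f by apply/measurable_EFinP; exact: measurable_int intf.
have mfK : measurable_fun setT (EFin \o (fun z : R * R => f z.1 * K z)).
  by apply/measurable_EFinP/measurable_funM => //; exact: measurableT_comp.
have mKx x : measurable_fun setT (fun y => (K (x, y))%:E).
  by apply/measurable_EFinP; apply: measurableT_comp => //; exact: measurable_pair1.
have intfK : mu2.-integrable setT (EFin \o (fun z => f z.1 * K z)).
  apply/integrable12ltyP => //=.
  have -> : (fun x => \int[mu]_y `|f x * K (x, y)|%:E)%E =
      (fun x => c%:E * `|(f x)%:E|)%E.
    apply/funext => x; rewrite -(Kc x) muleC -ge0_integralZl//; last 2 first.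
    - exact: mKx.
    - by move=> y _; rewrite lee_fin.
    by apply: eq_integral => y _; rewrite /= normrM (ger0_norm (K0 _)).
  have /integrableP[_ fy] := integrableZl measurableT c intf.
  apply: le_lt_trans fy; apply: ge0_le_integral => //.
  - move=> x _; rewrite mule_ge0// -(Kc x) integral_ge0// => y _; rewrite lee_fin//.
  - by apply: emeasurable_funM => //; apply: measurableT_comp => //; exact/measurable_EFinP.
  - by apply: measurableT_comp => //; apply: emeasurable_funM => //; exact/measurable_EFinP.
  - by move=> x _; rewrite /= -EFinM lee_fin normrM ler_wpM2r// ler_norm.
split => //.
rewrite -RintegralZl// /Rintegral; congr fine.
have /= <- := integral12_prod_meas1 intfK.
apply: eq_integral => x _; rewrite EFinM -(Kc x) muleC -integralZl//.
apply/integrableP; split; first exact: mKx.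
by under eq_integral do rewrite /= ger0_norm//; rewrite Kc ltry.
Qed.

Lemma kernel_snd (f : R -> R) : mu.-integrable setT (EFin \o f) ->
  mu2.-integrable setT (EFin \o (fun z => f z.2 * K z)) /\
  \int[mu2]_z (f z.2 * K z) = c * \int[mu]_x f x.
Proof.
move=> intf; have [ifK <-] := kernel_fst intf; rewrite (integral_swap ifK)/=; split.
  have mf : measurable_fun setT f by apply/measurable_EFinP; exact: measurable_int intf.
  apply/integrable21ltyP.
    by apply/measurable_EFinP/measurable_funM => //; exact: measurableT_comp.
  have /integrable12ltyP := ifK; under eq_integral => x _.
    under eq_integral => y _ do rewrite /= -KC/=.
    over.
  apply; by apply/measurable_EFinP/measurable_funM => //; exact: measurableT_comp.
by congr Rintegral; apply/funext => z; rewrite KC.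
Qed.

Lemma kernel_cross (u v : R -> R) : L2 mu u -> L2 mu v ->
  mu2.-integrable setT (EFin \o (fun z => u z.1 * v z.2 * K z)).
Proof.
move=> Lu Lv; have mu' := L2_measurable Lu; have mv := L2_measurable Lv.
have [i1 _] := kernel_fst (L2_integrableM Lu Lu).
have [i2 _] := kernel_snd (L2_integrableM Lv Lv).
apply: (le_integrable measurableT _ _ (integrableD measurableT i1 i2)).
  apply/measurable_EFinP/measurable_funM => //.
  by apply: measurable_funM; apply: measurableT_comp.
move=> z _; rewrite /= lee_fin -mulrDl !normrM (ger0_norm (K0 z)) ler_wpM2r//.
rewrite [leRHS]ger0_norm ?addr_ge0 -?expr2 ?sqr_ge0//.
rewrite -(real_normK (num_real (u z.1))) -(real_normK (num_real (v z.2))).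
move: (normr_ge0 (u z.1)) (normr_ge0 (v z.2)); set a := `|u _|; set b := `|v _|.
move=> a0 b0; have := sqr_ge0 (a - b); have := mulr_ge0 a0 b0; rewrite sqrrB; lra.
Qed.

(** Expanding the product: the diagonal terms see only the total mass c of the
    kernel, and the two cross terms agree by symmetry. *)
Lemma kernel_expand (u v : R -> R) : L2 mu u -> L2 mu v ->
  mu2.-integrable setT
    (EFin \o (fun z => (u z.1 - u z.2) * (v z.1 - v z.2) * K z)) /\
  \int[mu2]_z ((u z.1 - u z.2) * (v z.1 - v z.2) * K z) =
    2 * c * ip mu u v - 2 * \int[mu2]_z (u z.1 * v z.2 * K z).
Proof.
move=> Lu Lv.
have [i1 e1] := kernel_fst (L2_integrableM Lu Lv).
have [i2 e2] := kernel_snd (L2_integrableM Lu Lv).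
have i3 := kernel_cross Lu Lv.
have i4 := kernel_cross Lv Lu.
have e4 : \int[mu2]_z (v z.1 * u z.2 * K z) = \int[mu2]_z (u z.1 * v z.2 * K z).
  rewrite (integral_swap i4); congr Rintegral; apply/funext => z /=.
  by rewrite KC [v _ * _]mulrC.
pose f12 z := u z.1 * v z.1 * K z + u z.2 * v z.2 * K z.
pose f34 z := u z.1 * v z.2 * K z + v z.1 * u z.2 * K z.
have i12 : mu2.-integrable setT (EFin \o f12) by exact: (integrableD measurableT i1 i2).
have i34 : mu2.-integrable setT (EFin \o f34) by exact: (integrableD measurableT i3 i4).
have -> : (fun z => (u z.1 - u z.2) * (v z.1 - v z.2) * K z) = (fun z => f12 z - f34 z).
  by apply/funext => z; rewrite /f12 /f34; ring.
split; first exact: (integrableB measurableT i12 i34).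
rewrite RintegralB// /f12 /f34 !RintegralD// e1 e2 e4 /ip; ring.
Qed.

End Kernel.
End SymmetricKernel.

(** * Weighted increments and their truncation radius *)

Section NearKernel.
Context (R : realType).
Notation mu := (@lebesgue_measure R).
(** The cases s = 1 and s = -1 treat the two sides of x at once. *)
Lemma integral_inv (s x p q : R) : s ^+ 2 = 1 -> p < q ->
  0 < s * (p - x) -> 0 < s * (q - x) ->
  (\int[mu]_(y in `[p, q]) ((s * (y - x))^-1)%:E =
   (s * ln (s * (q - x)) - s * ln (s * (p - x)))%:E)%E.
Proof.
move=> s2 pq xp xq.
have pos y : p <= y <= q -> 0 < s * (y - x).
  have /eqP : (s - 1) * (s + 1) = 0 by rewrite -subr_sqr expr1n s2 subrr.
  rewrite mulf_eq0 subr_eq0 addr_eq0 => /orP[] /eqP se; move: xp xq; rewrite se; lra.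
have dF y : p <= y <= q ->
    is_derive y 1 (fun y => s * ln (s * (y - x))) ((s * (y - x))^-1).
  move=> /pos ypos.
  have h := is_derive1_ln ypos.
  have h2 : is_derive y 1 (fun y => s * (y - x)) s.
    apply: is_derive_eq.
    by rewrite /GRing.scale /= subr0 mulr1.
  have h3 := @is_derive1_comp _ (@ln R) (fun y => s * (y - x)) y _ _ h h2.
  have h4 := is_deriveZ s h3.
  apply: (is_derive_eq h4).
  by rewrite /GRing.scale /= mulrCA -expr2 s2 mulr1.
have cF y : p <= y <= q -> {for y, continuous (fun y => s * ln (s * (y - x)))}.
  move=> /dF [d _]; apply: differentiable_continuous; exact/derivable1_diffP.
rewrite (@continuous_FTC2 _ _ (fun y => s * ln (s * (y - x))))//.
- apply: continuous_in_subspaceT => y; rewrite inE/= in_itv/= => /pos ypos.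
  apply: cvgV; first by rewrite gt_eqF.
  by apply: cvgM; [exact: cvg_cst|apply: cvgB => //; exact: cvg_cst].
- split.
  + by move=> y; rewrite in_itv/= => /andP[/ltW py /ltW yq]; have [] := dF y; rewrite ?py.
  + by apply: cvg_at_right_filter; apply: cF; rewrite lexx ltW.
  + by apply: cvg_at_left_filter; apply: cF; rewrite lexx ltW.
- move=> y; rewrite in_itv/= => /andP[/ltW py /ltW yq]; rewrite derive1E.
  by have [] := dF y; rewrite ?py.
Qed.

Notation mu2 := (mu \x mu)%E.

Definition near_kernel (r : R) (z : R * R) : R :=
  (`|z.1 - z.2| <= r)%R%:R / `|z.1 - z.2|.

Definition annulus (a b : R) (z : R * R) : R :=
  (a < `|z.1 - z.2| <= b)%R%:R / `|z.1 - z.2|.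

(** The square root makes the near part of the form an L^2 product on the plane:
    the product of the increments of u and v is the integrand. *)
Definition increment (r : R) (u : R -> R) (z : R * R) : R :=
  (u z.1 - u z.2) * Num.sqrt (near_kernel r z).

Lemma measurable_dist : measurable_fun setT (fun z : R * R => `|z.1 - z.2|).
Proof. by apply: measurableT_comp => //; exact: measurable_funB. Qed.

Lemma measurable_inv_dist : measurable_fun setT (fun z : R * R => `|z.1 - z.2|^-1).
Proof.
have -> : (fun z : R * R => `|z.1 - z.2|^-1) = (fun z => `|z.1 - z.2| `^ (-1)).
  by apply/funext => z; rewrite powR_inv1.
by apply: (measurableT_comp (measurable_powR _)) => //; exact: measurable_dist.
Qed.

Lemma measurable_indicator (P : R * R -> bool) : measurable_fun setT P ->
  measurable_fun setT (fun z => (P z)%:R : R).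
Proof.
move=> mP; have -> : (fun z => (P z)%:R : R) = (fun z => if P z then 1 else 0).
  by apply/funext => z; case: (P z).
exact: measurable_fun_ifT.
Qed.

Lemma measurable_near_kernel r : measurable_fun setT (near_kernel r).
Proof.
apply: measurable_funM; last exact: measurable_inv_dist.
by apply: measurable_indicator; apply: measurable_fun_ler => //; exact: measurable_dist.
Qed.

Lemma measurable_annulus a b : measurable_fun setT (annulus a b).
Proof.
apply: measurable_funM; last exact: measurable_inv_dist.
apply: measurable_indicator; apply: measurable_and.
  by apply: measurable_fun_ltr => //; exact: measurable_dist.
by apply: measurable_fun_ler => //; exact: measurable_dist.
Qed.

Lemma near_kernel_ge0 r z : 0 <= near_kernel r z.
Proof. by rewrite mulr_ge0 ?invr_ge0. Qed.

Lemma annulus_ge0 a b z : 0 <= annulus a b z.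
Proof. by rewrite mulr_ge0 ?invr_ge0. Qed.

Lemma annulusC a b z : annulus a b (z.2, z.1) = annulus a b z.
Proof. by rewrite /annulus/= distrC. Qed.

Lemma near_kernel_annulus a b z : a <= b ->
  near_kernel b z = near_kernel a z + annulus a b z.
Proof.
move=> ab; rewrite /near_kernel /annulus -mulrDl; congr (_ / _).
have [za|az] := leP `|z.1 - z.2| a; first by rewrite (le_trans za ab) addr0.
by rewrite add0r.
Qed.

Lemma integral_annulus (a b x : R) : 0 < a -> a <= b ->
  (\int[mu]_y (annulus a b (x, y))%:E = (2 * ln (b / a))%:E)%E.
Proof.
move=> a0; rewrite le_eqVlt => /predU1P[<-|ab].
  rewrite divff ?gt_eqF// ln1 mulr0 integral0_eq// => y _.
  by rewrite /annulus/= leNgt andbN mul0r.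
have b0 : 0 < b by exact: lt_trans ab.
pose f y : \bar R := (`|x - y|^-1)%:E.
pose A := `]x + a, x + b]%classic : set R.
pose B := `[x - b, x - a[%classic : set R.
have mf : measurable_fun setT f.
  apply/measurable_EFinP.
  exact: (measurableT_comp measurable_inv_dist (measurable_pair1 x)).
have f0 y : (0 <= f y)%E by rewrite lee_fin invr_ge0.
have mA : measurable A by exact: measurable_itv.
have mB : measurable B by exact: measurable_itv.
have -> : (fun y => (annulus a b (x, y))%:E) = f \_ (A `|` B).
  apply/funext => y; rewrite /annulus patchE/=.
  suff -> : (y \in A `|` B) = (a < `|x - y| <= b) by case: ifP => _; rewrite ?mul1r ?mul0r.
  apply/idP/idP; rewrite inE /A /B /= !in_itv/=.
    have [xy|yx] := leP x y.
      by rewrite ler0_norm ?subr_le0//; lra.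
    by rewrite gtr0_norm ?subr_gt0//; lra.
  have [xy|yx] := leP x y.
    by rewrite ler0_norm ?subr_le0// => ?; left; lra.
  by rewrite gtr0_norm ?subr_gt0// => ?; right; lra.
rewrite -integral_mkcond ge0_integral_setU//=; last 2 first.
- exact: measurable_funTS.
- by apply/disj_setPS => y []; rewrite /A /B /= !in_itv/=; lra.
rewrite integral_itv_obnd_cbnd; last exact: measurable_funTS.
rewrite integral_itv_bndo_bndc; last exact: measurable_funTS.
have -> : (\int[mu]_(y in `[(x + a)%R, (x + b)%R]) f y =
    \int[mu]_(y in `[(x + a)%R, (x + b)%R]) ((1 * (y - x))^-1)%:E)%E.
  apply: eq_integral => y; rewrite inE/= in_itv/= => /andP[xy _].
  by rewrite /f mul1r distrC gtr0_norm//; lra.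
have -> : (\int[mu]_(y in `[(x - b)%R, (x - a)%R]) f y =
    \int[mu]_(y in `[(x - b)%R, (x - a)%R]) ((-1 * (y - x))^-1)%:E)%E.
  apply: eq_integral => y; rewrite inE/= in_itv/= => /andP[_ xy].
  by rewrite /f mulN1r opprB gtr0_norm//; lra.
have N12 : (-1) ^+ 2 = 1 :> R by rewrite sqrrN expr1n.
rewrite (integral_inv (expr1n _ _)); [|lra..].
rewrite (integral_inv N12); [|lra..].
rewrite -EFinD; congr EFin; rewrite ln_div ?posrE//.
have -> : 1 * (x + b - x) = b by ring.
have -> : 1 * (x + a - x) = a by ring.
have -> : -1 * (x - b - x) = b by ring.
have -> : -1 * (x - a - x) = a by ring.
ring.
Qed.

Lemma increment_sqr r u z :
  increment r u z ^+ 2 = (u z.1 - u z.2) ^+ 2 * near_kernel r z.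
Proof. by rewrite exprMn sqr_sqrtr// near_kernel_ge0. Qed.

Lemma incrementM r u v z : increment r u z * increment r v z =
  (u z.1 - u z.2) * (v z.1 - v z.2) * near_kernel r z.
Proof. by rewrite mulrACA -expr2 sqr_sqrtr// near_kernel_ge0. Qed.

Lemma increment_lin r c u v : increment r (c *: u + v) = c *: increment r u + increment r v.
Proof.
apply/funext => z; rewrite /increment.
rewrite -[(c *: u + v) z.1]/(c * u z.1 + v z.1) -[(c *: u + v) z.2]/(c * u z.2 + v z.2).
rewrite -[RHS]/(c * ((u z.1 - u z.2) * Num.sqrt (near_kernel r z)) +
  (v z.1 - v z.2) * Num.sqrt (near_kernel r z)); ring.
Qed.

Lemma measurable_increment r u : measurable_fun setT u ->
  measurable_fun setT (increment r u).
Proof.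
move=> mu'; apply: measurable_funM.
  by apply: measurable_funB; apply: measurableT_comp.
exact: (measurableT_comp (continuous_measurable_fun (@sqrt_continuous R))
  (measurable_near_kernel r)).
Qed.

Section Radius.
Variables (a b : R) (a0 : 0 < a) (ab : a <= b).

Let ann_expand u v := @kernel_expand R (annulus a b) (2 * ln (b / a))
  (@measurable_annulus a b) (@annulus_ge0 a b) (@annulusC a b)
  (fun x => integral_annulus x a0 ab) u v.

(** The annulus kernel is integrable, so the radius does not affect whether the
    increments are square integrable. *)
Lemma increment_radius u : L2 mu u ->
  L2 mu2 (increment a u) <-> L2 mu2 (increment b u).
Proof.
move=> Lu; have mu' := L2_measurable Lu.
have [iann _] := ann_expand Lu Lu.
have mi r := measurable_increment r mu'.
split=> Li; last first.
  apply: (@L2_le _ _ _ mu2 (increment b u)) => [|z|//]; [exact: mi|rewrite !normrM ler_wpM2l// !ger0_norm ?sqrtr_ge0//].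
  by rewrite ler_sqrt ?near_kernel_ge0// (near_kernel_annulus z ab) lerDl annulus_ge0.
apply/L2P; split; first exact: mi.
under eq_integral do rewrite increment_sqr (near_kernel_annulus _ ab) mulrDr EFinD.
have mdu : measurable_fun setT (fun z : R * R => (u z.1 - u z.2) ^+ 2).
  by apply: measurable_funX; apply: measurable_funB; apply: measurableT_comp.
rewrite ge0_integralD//=; last 4 first.
- by move=> z _; rewrite lee_fin mulr_ge0 ?sqr_ge0 ?near_kernel_ge0.
- by apply/measurable_EFinP/measurable_funM => //; exact: measurable_near_kernel.
- by move=> z _; rewrite lee_fin mulr_ge0 ?sqr_ge0 ?annulus_ge0.
- by apply/measurable_EFinP/measurable_funM => //; exact: measurable_annulus.
rewrite lte_add_pinfty//.
  by have := L2_int Li; under eq_integral do rewrite increment_sqr.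
have /integrableP[_] := iann; apply: le_lt_trans; rewrite le_eqVlt; apply/predU1P; left.
by apply: eq_integral => z _; rewrite /= -expr2 ger0_norm// mulr_ge0 ?sqr_ge0 ?annulus_ge0.
Qed.

(** The identity behind the logarithm: 4 ln (b / a) is twice the mass of the
    annulus kernel. *)
Lemma ip_increment_radius u v : L2 mu u -> L2 mu v ->
  L2 mu2 (increment a u) -> L2 mu2 (increment a v) ->
  ip mu2 (increment b u) (increment b v) = ip mu2 (increment a u) (increment a v)
    + 4 * ln (b / a) * ip mu u v - 2 * \int[mu2]_z (u z.1 * v z.2 * annulus a b z).
Proof.
move=> Lu Lv Liu Liv; have [iann eann] := ann_expand Lu Lv.
have ia := L2_integrableM Liu Liv.
rewrite /ip; under [in LHS]eq_Rintegral => z _ do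
  rewrite incrementM (near_kernel_annulus _ ab) mulrDr -incrementM.
by rewrite RintegralD// eann /ip; ring.
Qed.

End Radius.
End NearKernel.

(** * The logarithmic form in terms of increments *)

Section LogForm.
Context (R : realType).
Notation mu := (@lebesgue_measure R).
Notation mu2 := (mu \x mu)%E.

(** The product carries several convertible measurable structures; fixing the
    one of R * R here lets almost everywhere facts on the plane be combined. *)
Lemma ae2S (P Q : R * R -> Prop) : (forall z, P z -> Q z) ->
  {ae mu2, forall z : R * R, P z} -> {ae mu2, forall z : R * R, Q z}.
Proof. by move=> PQ; apply: (@filterS _ _ (ae_filter_ringOfSetsType mu2)). Qed.

Lemma ae2I (P Q : R * R -> Prop) : {ae mu2, forall z : R * R, P z} ->
  {ae mu2, forall z : R * R, Q z} -> {ae mu2, forall z : R * R, P z /\ Q z}.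
Proof. exact: (@filterI _ _ (ae_filter_ringOfSetsType mu2)). Qed.

Lemma ae_fst (P : R -> Prop) : {ae mu, forall x, P x} -> {ae mu2, forall z : R * R, P z.1}.
Proof.
move=> [N [mN N0 PN]]; exists (N `*` setT); split.
- exact: measurableX.
- by rewrite product_measure1E// [X in (X * _)%E]N0 mul0e.
- by move=> z /= nP; split => //; apply: PN.
Qed.

Lemma ae_snd (P : R -> Prop) : {ae mu, forall x, P x} -> {ae mu2, forall z : R * R, P z.2}.
Proof.
move=> [N [mN N0 PN]]; exists (setT `*` N); split.
- exact: measurableX.
- by rewrite product_measure1E// [X in (_ * X)%E]N0 mule0.
- by move=> z /= nP; split => //; apply: PN.
Qed.

(** The near and far parts of the form overlap where |x - y| = 1, which is a null
    set. *)
Lemma ae_dist_neq (r : R) : {ae mu2, forall z : R * R, `|z.1 - z.2| != r}.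
Proof.
pose A := [set z : R * R | `|z.1 - z.2| == r].
have mA : measurable A.
  rewrite -[A]setTI; apply: (measurable_fun_eqr (@measurable_dist R) (measurable_cst r)) => //.
  
exists A; split => //; last by move=> z /= /negP/negPn.
apply: integral0_eq => x _; apply: countable_lebesgue_measure0.
apply: (@sub_countable _ _ _ [set x - r; x + r]).
  apply: subset_card_le => y; rewrite /xsection/= inE /A/= => /eqP <-.
  have [xy|yx] := leP x y; [right; rewrite ler0_norm ?subr_le0//|left; rewrite gtr0_norm ?subr_gt0//]; ring.
apply: finite_set_countable; exact: finite_set2.
Qed.

Lemma near_kernel1_patch (x : R) (f : R -> R) y :
  ((fun y => (f y / `|x - y|)%:E) \_ `[x - 1, x + 1]) y =
  (f y * near_kernel 1 (x, y))%:E.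
Proof.
rewrite patchE /near_kernel/=.
suff -> : (y \in `[x - 1, x + 1]%classic) = (`|x - y| <= 1) by case: ifP; rewrite ?mul1r ?mul0r ?mulr0.
by rewrite mem_setE in_itv/= ler_distlC.
Qed.

Lemma logspaceP (Om : set R) u : logspace Om u <->
  [/\ L2 mu u, {ae mu, forall x, ~ Om x -> u x = 0} & L2 mu2 (increment 1 u)].
Proof.
rewrite /logspace/=.
have E : measurable_fun setT u -> (\int[mu]_x \int[mu]_(y in `[(x - 1)%R, (x + 1)%R])
    (`|u x - u y| ^+ 2 / `|x - y|)%:E = \int[mu2]_z (increment 1 u z ^+ 2)%:E)%E.
  move=> mu'; rewrite fubini_tonelli1.
  - apply: eq_integral => x _; rewrite integral_mkcond; apply: eq_integral => y _.
    rewrite increment_sqr/= -(real_normK (num_real (u x - u y))).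
    exact: (near_kernel1_patch x (fun y => `|u x - u y| ^+ 2)).
  - by apply/measurable_EFinP/measurable_funX; exact: measurable_increment.
  - by move=> z; rewrite lee_fin sqr_ge0.
split=> -[Lu u0 ui]; have mu' := L2_measurable Lu; split => //.
  by apply/L2P; split; [exact: measurable_increment|rewrite -E].
by rewrite E//; exact: L2_int.
Qed.

Lemma near_formE u v : L2 mu2 (increment 1 u) -> L2 mu2 (increment 1 v) ->
  \int[mu]_x \int[mu]_(y in `[x - 1, x + 1]) ((u x - u y) * (v x - v y) / `|x - y|)
  = ip mu2 (increment 1 u) (increment 1 v).
Proof.
move=> Lu Lv; have i := L2_integrableM Lu Lv.
have iF := integrable_fubini_F i.
have FE x : \int[mu]_(y in `[x - 1, x + 1]) ((u x - u y) * (v x - v y) / `|x - y|) =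
    fine (fubini_F mu (EFin \o (fun z => increment 1 u z * increment 1 v z)) x).
  rewrite /Rintegral integral_mkcond; congr fine; apply: eq_integral => y _.
  rewrite /= incrementM.
  exact: (near_kernel1_patch x (fun y => (u x - u y) * (v x - v y))).
rewrite [RHS]/Rintegral -(integral12_prod_meas1 i); congr fine.
have mF := measurable_int _ iF.
apply: ae_eq_integral => //.
- under eq_fun do rewrite FE; apply/measurable_EFinP.
  exact: (measurableT_comp (fine_measurable measurableT) mF).
- by have := integrable_ae measurableT iF; apply: filterS => x Fx _; rewrite FE fineK// Fx.
Qed.

Lemma ae_close_supports (L : R) (u v : R -> R) :
  {ae mu, forall x, ~ `]- L, L[%classic x -> u x = 0} ->
  {ae mu, forall x, ~ `]- L, L[%classic x -> v x = 0} ->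
  {ae mu2, forall z : R * R, u z.1 * v z.2 != 0 -> `|z.1 - z.2| < 2 * L}.
Proof.
move=> u0 v0; have uz := ae_fst u0; have vz := ae_snd v0.
apply: (ae2S _ (ae2I uz vz)) => z [uz0 vz0]; rewrite mulf_eq0 negb_or => /andP[un vn].
have : `]- L, L[%classic z.1.
  by apply: contrapT => /uz0 /eqP; rewrite (negPf un).
have : `]- L, L[%classic z.2.
  by apply: contrapT => /vz0 /eqP; rewrite (negPf vn).
by rewrite /= !in_itv/= ltr_norml; lra.
Qed.

Definition far_form (u v : R -> R) : R :=
  \int[mu2]_(z in [set z | 1 <= `|z.1 - z.2|]) (u z.1 * v z.2 / `|z.1 - z.2|).

Lemma far_formE (L : R) u v : L2 mu u -> L2 mu v ->
  {ae mu, forall x, ~ `]- L, L[%classic x -> u x = 0} ->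
  {ae mu, forall x, ~ `]- L, L[%classic x -> v x = 0} ->
  far_form u v = \int[mu2]_z (u z.1 * v z.2 * annulus 1 (2 * L) z).
Proof.
move=> Lu Lv u0 v0; have mu' := L2_measurable Lu; have mv := L2_measurable Lv.
have -> : far_form u v =
    \int[mu2]_z (u z.1 * v z.2 * ((1 <= `|z.1 - z.2|)%R%:R / `|z.1 - z.2|)).
  rewrite /far_form Rintegral_mkcond; congr Rintegral; apply/funext => z.
  rewrite patchE.
  have -> : (z \in [set z : R * R | 1 <= `|z.1 - z.2|]) = (1 <= `|z.1 - z.2|).
    by apply/idP/idP; rewrite inE.
  by case: ifP => _; rewrite ?mul1r ?mul0r ?mulr0.
have muv : measurable_fun setT (fun z : R * R => u z.1 * v z.2).
  by apply: measurable_funM; apply: measurableT_comp.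
apply: eq_ae_Rintegral.
- apply: measurable_funM => //; apply: measurable_funM; last exact: measurable_inv_dist.
  by apply: measurable_indicator; apply: measurable_fun_ler => //; exact: measurable_dist.
- by apply: measurable_funM => //; exact: measurable_annulus.
apply: (ae2S _ (ae2I (ae_close_supports u0 v0) (ae_dist_neq 1))) => z [zL z1]; rewrite /annulus.
have [uv0|uvn] := eqVneq (u z.1 * v z.2) 0; first by rewrite uv0 !mul0r.
by rewrite (ltW (zL uvn)) andbT lt_neqAle eq_sym z1.
Qed.

(** If s = 2 L >= 1, enlarging the radius from 1 to s produces, besides the
    logarithm, exactly the far interaction.  If s <= 1, that interaction is void and
    so is the product term when the radius grows from s to 1. *)
Lemma log_formE (L : R) u v : 0 < L ->
  logspace `]- L, L[ u -> logspace `]- L, L[ v ->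
  log_form u v = 2^-1 * ip mu2 (increment (2 * L) u) (increment (2 * L) v)
    + (rho1 - 2 * ln (2 * L)) * ip mu u v.
Proof.
move=> L0 /logspaceP[Lu u0 ui] /logspaceP[Lv v0 vi].
have s0 : 0 < 2 * L by rewrite mulr_gt0.
rewrite /log_form near_formE// -/(far_form u v) (far_formE Lu Lv u0 v0) -/(ip mu u v).
have [s1|/ltW s1] := leP 1 (2 * L).
  rewrite (ip_increment_radius ltr01 s1 Lu Lv ui vi) divr1; lra.
have iu := (increment_radius s0 s1 Lu).2 ui.
have iv := (increment_radius s0 s1 Lv).2 vi.
rewrite (ip_increment_radius s0 s1 Lu Lv iu iv) div1r lnV ?posrE//.
have ann0 a b : 2 * L <= a -> \int[mu2]_z (u z.1 * v z.2 * annulus a b z) = 0.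
  move=> sa; have [mu' mv] := (L2_measurable Lu, L2_measurable Lv).
  have -> : 0 = Rintegral mu2 setT (fun _ : R * R => 0 : R) by rewrite Rintegral_cst// mul0r.
  apply: eq_ae_Rintegral => //.
    apply: measurable_funM; last exact: measurable_annulus.
    by apply: measurable_funM; apply: measurableT_comp.
  apply: (ae2S _ (ae_close_supports u0 v0)) => z zL; rewrite /annulus.
  have [->|/zL zs] := eqVneq (u z.1 * v z.2) 0; first by rewrite mul0r.
  by rewrite (lt_gtF (lt_le_trans zs sa)) mul0r mulr0.
rewrite !ann0//; lra.
Qed.

End LogForm.

(** * A Poincare inequality over all dyadic scales *)

Section Dyadic.
Context (R : realType).
Notation mu := (@lebesgue_measure R).
Notation mu2 := (mu \x mu)%E.

(** The left endpoint, in units of the length 2 ^- k, of the dyadic interval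
    that contains x; kept in R so that measurability is that of a monotone
    function. *)
Definition cell (k : nat) (x : R) : R := (Num.floor (2 ^+ k * x))%:~R.

Definition cell_kernel (k : nat) (z : R * R) : R := (cell k z.1 == cell k z.2)%:R.

Lemma measurable_cell k : measurable_fun setT (cell k).
Proof.
apply: nondecreasing_measurable => // x y xy.
by rewrite /cell ler_int le_floor// ler_wpM2l// exprn_ge0.
Qed.

Lemma measurable_cell_kernel k : measurable_fun setT (cell_kernel k).
Proof.
apply: measurable_indicator; apply: measurable_fun_eqr.
  exact: (measurableT_comp (measurable_cell k)).
exact: (measurableT_comp (measurable_cell k)).
Qed.

Lemma cell_kernel_ge0 k z : 0 <= cell_kernel k z. Proof. exact: ler0n. Qed.

Lemma cell_kernelC k z : cell_kernel k (z.2, z.1) = cell_kernel k z.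
Proof. by rewrite /cell_kernel/= eq_sym. Qed.

Lemma cellE k x y : (cell k x == cell k y) =
  (cell k x / 2 ^+ k <= y < (cell k x + 1) / 2 ^+ k).
Proof.
have k0 : 0 < 2 ^+ k :> R by rewrite exprn_gt0.
rewrite /cell eqr_int eq_sym floor_eq intrD.
by rewrite ler_pdivrMr// ltr_pdivlMr// ![_ * y]mulrC.
Qed.

Lemma integral_cell_kernel k x :
  (\int[mu]_y (cell_kernel k (x, y))%:E = (2^-1 ^+ k)%:E)%E.
Proof.
have k0 : 0 < 2 ^+ k :> R by rewrite exprn_gt0.
pose A := `[cell k x / 2 ^+ k, (cell k x + 1) / 2 ^+ k[%classic : set R.
have -> : (fun y => (cell_kernel k (x, y))%:E) = (fun y => (\1_A y)%:E).
  apply/funext => y; rewrite /cell_kernel/= cellE indicE; congr ((_ : bool)%:R%:E).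
  by rewrite mem_setE in_itv.
rewrite integral_indic//; last exact: measurable_itv.
rewrite /= setIT /A lebesgue_measure_itv/= lte_fin ltr_pM2r ?invr_gt0// ltrDl ltr01.
by rewrite -EFinD -mulrBl addrC addKr mul1r exprVn.
Qed.

Lemma sum_pow2 n : \sum_(k < n) 2 ^+ k = 2 ^+ n - 1 :> R.
Proof.
elim: n => [|n IH]; first by rewrite big_ord0 expr0 subrr.
rewrite big_ord_recr/= IH exprS; ring.
Qed.

(** Two points lie in a common dyadic interval of length 2 ^- k only if their
    distance is smaller, so the sum is geometric and dominated by its last
    nonzero term. *)
Lemma sum_cell_kernel n z : z.1 != z.2 ->
  \sum_(k < n) 2 ^+ k * cell_kernel k z <= 2 * near_kernel 1 z.
Proof.
move=> z12; have t0 : 0 < `|z.1 - z.2| by rewrite normr_gt0 subr_eq0.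
set t := `|z.1 - z.2| in t0 *.
have close k : cell_kernel k z != 0 -> 2 ^+ k * t < 1.
  have k0 : 0 < 2 ^+ k :> R by rewrite exprn_gt0.
  rewrite pnatr_eq0 eqb0 negbK => /eqP e.
  rewrite /t -[2 ^+ k]gtr0_norm// -normrM mulrBr ltr_norml.
  have := floor_itv (2 ^+ k * z.1); have := floor_itv (2 ^+ k * z.2).
  rewrite !intrD -!/(cell k _) e; lra.
have [t1|t1] := leP t 1; last first.
  rewrite big1 ?mulr_ge0 ?near_kernel_ge0// => k _; apply/eqP.
  rewrite mulf_eq0; apply/orP; right; apply: contraT => /close h.
  suff : 1 <= 2 ^+ k * t by rewrite leNgt h.
  by rewrite (le_trans (ltW t1))// ler_peMl ?exprn_ege1 ?ler1n// ltW.
rewrite /near_kernel -/t t1 mul1r.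
elim: n => [|n IH]; first by rewrite big_ord0 divr_ge0// ltW.
have [n0|/close nt] := eqVneq (cell_kernel n z) 0.
  by rewrite big_ord_recr/= n0 mulr0 addr0.
rewrite ler_pdivlMr//.
have sle : \sum_(k < n.+1) 2 ^+ k * cell_kernel k z <= 2 ^+ n.+1.
  rewrite (le_trans (y := \sum_(k < n.+1) 2 ^+ k))//; last first.
    by rewrite sum_pow2 gerBl ler01.
  by apply: ler_sum => k _; rewrite ler_piMr ?exprn_ge0// /cell_kernel lern1 leq_b1.
apply: (le_trans (ler_wpM2r (ltW t0) sle)).
by rewrite exprS -mulrA; lra.
Qed.

(** The log-scale Poincare inequality: each of the first n dyadic scales
    contributes the whole L^2 norm, up to the means of w on dyadic intervals,
    while all scales together are controlled by the increments. *)
Lemma dyadic_poincare n w : L2 mu w -> L2 mu2 (increment 1 w) ->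
  n%:R * ip mu w w <= ip mu2 (increment 1 w) (increment 1 w) +
    \sum_(k < n) 2 ^+ k * \int[mu2]_z (w z.1 * w z.2 * cell_kernel k z).
Proof.
move=> Lw Li.
pose F k z := 2 ^+ k * ((w z.1 - w z.2) * (w z.1 - w z.2) * cell_kernel k z).
have exp k := @kernel_expand R (cell_kernel k) (2^-1 ^+ k) (measurable_cell_kernel k)
  (cell_kernel_ge0 k) (cell_kernelC k) (integral_cell_kernel k) w w Lw Lw.
have iF k : mu2.-integrable setT (EFin \o F k).
  exact: (integrableZl measurableT (2 ^+ k) (exp k).1).
have isF m : mu2.-integrable setT (EFin \o (fun z => \sum_(k < m) F k z)).
  elim: m => [|m IH].
    by under eq_fun do rewrite /= big_ord0; exact: integrable0.
  under eq_fun do rewrite /= big_ord_recr/=.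
  exact: (integrableD measurableT IH (iF m)).
have sumF m : \int[mu2]_z (\sum_(k < m) F k z) = \sum_(k < m) \int[mu2]_z F k z.
  elim: m => [|m IH].
    rewrite big_ord0; under eq_Rintegral do rewrite big_ord0.
    by rewrite Rintegral_cst// mul0r.
  rewrite big_ord_recr/= -IH -RintegralD//.
  by congr Rintegral; apply/funext => z; rewrite big_ord_recr.
have : \int[mu2]_z (\sum_(k < n) F k z) <=
    2 * ip mu2 (increment 1 w) (increment 1 w).
  rewrite /ip -RintegralZl//; last exact: L2_integrableM.
  apply: le_Rintegral => //.
    exact: (integrableZl measurableT 2 (L2_integrableM Li Li)).
  move=> z _; rewrite incrementM /F.
  have [z12|z12] := eqVneq z.1 z.2.
    by rewrite z12 subrr !mul0r mulr0 big1// => k _; rewrite mul0r mulr0.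
  have := sum_cell_kernel n z12 => h.
  under eq_bigr do rewrite mulrCA; rewrite -mulr_sumr mulrCA.
  by rewrite ler_wpM2l// -expr2 sqr_ge0.
rewrite sumF.
have -> : \sum_(k < n) \int[mu2]_z F k z = \sum_(k < n) (2 * ip mu w w -
   2 * (2 ^+ k * \int[mu2]_z (w z.1 * w z.2 * cell_kernel k z))).
  apply: eq_bigr => k _; rewrite RintegralZl ?(exp k).2//; last exact: (exp k).1.
  have -> : 2^-1 ^+ k = (2 ^+ k)^-1 :> R by rewrite exprVn.
  have k0 : 2 ^+ k != 0 :> R by rewrite expf_neq0.
  by field.
rewrite sumrB sumr_const card_ord -mulr_sumr -mulr_natl.
lra.
Qed.

End Dyadic.

Section Compactness.
Context (R : realType).
Notation mu := (@lebesgue_measure R).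
Notation mu2 := (mu \x mu)%E.
Notation Om := (`]- 2^-1, 2^-1[%classic : set R).

Definition cell_indicator (k : nat) (x y : R) : R := cell_kernel k (x, y).

Lemma L2_cell_indicator k x : L2 mu (cell_indicator k x).
Proof.
apply/L2P; split.
  exact: (measurableT_comp (measurable_cell_kernel k) (measurable_pair1 x)).
have -> : (fun y => (cell_indicator k x y ^+ 2)%:E) = (fun y => (cell_kernel k (x, y))%:E).
  by apply/funext => y; rewrite /cell_indicator /cell_kernel; case: eqP => _; rewrite ?expr1n ?expr0n.
by rewrite integral_cell_kernel ltry.
Qed.

(** By Fubini the double integral is the pairing of w with its integrals over
    dyadic intervals, and |w| <= 1 + w ^ 2 on the interval. *)
Lemma cell_cross_le k w eta : L2 mu w -> {ae mu, forall x, ~ Om x -> w x = 0} ->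
  (forall x, Om x -> `|ip mu w (cell_indicator k x)| <= eta) ->
  \int[mu2]_z (w z.1 * w z.2 * cell_kernel k z) <= eta * (1 + ip mu w w).
Proof.
move=> Lw w0 weta; have mw := L2_measurable Lw.
have eta0 : 0 <= eta by apply: le_trans (weta 0 _); rewrite ?normr_ge0//= in_itv/=; lra.
have i := kernel_cross (@measurable_cell_kernel R k)
  (@cell_kernel_ge0 R k) (@cell_kernelC R k) (@integral_cell_kernel R k) Lw Lw.
have iF := integrable_fubini_F i; have mF := measurable_int _ iF.
have FE x : fubini_F mu (EFin \o (fun z => w z.1 * w z.2 * cell_kernel k z)) x =
    (w x * ip mu w (cell_indicator k x))%:E.
  rewrite EFinM /ip /Rintegral fineK; last first.
    exact/integrable_fin_num/(L2_integrableM Lw (L2_cell_indicator k x)).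
  rewrite -integralZl//; last exact: (L2_integrableM Lw (L2_cell_indicator k x)).
  by apply: eq_integral => y _; rewrite /= -mulrA.
have mOm : measurable Om by exact: measurable_itv.
rewrite -lee_fin /Rintegral fineK; last exact: integrable_fin_num.
rewrite -(integral12_prod_meas1 i).
apply: (le_trans (lee_abs _)); apply: (le_trans (le_abse_integral _ measurableT mF)).
have -> : (eta * (1 + ip mu w w))%:E = (\int[mu]_x (eta * (\1_Om x + w x ^+ 2))%:E)%E.
  under eq_integral do rewrite EFinM.
  have m1 : measurable_fun setT (fun x => (\1_Om x + w x ^+ 2)%:E).
    apply/measurable_EFinP; apply: measurable_funD; first exact: measurable_indic.
    exact: measurable_funX.
  rewrite ge0_integralZl//; last by move=> x _; rewrite lee_fin addr_ge0 ?sqr_ge0.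
  rewrite EFinM; congr (_ * _)%E.
  under eq_integral do rewrite EFinD.
  rewrite ge0_integralD//; last 3 first.
  - by apply/measurable_EFinP; exact: measurable_indic.
  - by move=> x _; rewrite lee_fin sqr_ge0.
  - by apply/measurable_EFinP; exact: measurable_funX.
  rewrite EFinD ipE// integral_indic//= setIT lebesgue_measure_itv/= lte_fin.
  rewrite ifT; last by lra.
  by congr (_ + _)%E; rewrite -EFinB; congr EFin; lra.
apply: ae_ge0_le_integral => //.
- exact: measurableT_comp.
- by move=> x _; rewrite lee_fin mulr_ge0 ?addr_ge0 ?sqr_ge0.
- apply/measurable_EFinP; apply: measurable_funM => //.
  apply: measurable_funD; first exact: measurable_indic.
  exact: measurable_funX.
apply: (@filterS _ _ (ae_filter_ringOfSetsType mu) _ _ _ w0) => x {}w0 _; rewrite FE lee_fin normrM.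
have [Omx|/w0 ->] := pselect (Om x); last first.
  by rewrite normr0 mul0r mulr_ge0 ?addr_ge0 ?sqr_ge0.
rewrite indicE mem_set// mulrC; apply: ler_pM => //; first exact: weta.
rewrite -(real_normK (num_real (w x))).
have := sqr_ge0 (`|w x| - 1); have := normr_ge0 (w x); rewrite sqrrB /=; lra.
Qed.

(** Finitely many dyadic intervals of each length meet the interval; they are
    indexed by their left endpoints. *)
Lemma cell_grid k x : Om x -> exists i : 'I_(2 ^ k.+1),
  cell k x = cell k ((i%:R - 2 ^+ k) / 2 ^+ k).
Proof.
rewrite /= in_itv/= => /andP[x1 x2].
have k0 : 0 < 2 ^+ k :> R by rewrite exprn_gt0.
pose m := Num.floor (2 ^+ k * x) + (2 ^ k)%:Z.
have h1 : - 2 ^+ k <= 2 ^+ k * x by rewrite -mulrN1 ler_wpM2l//; lra.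
have h2 : 2 ^+ k * x < 2 ^+ k by rewrite -[ltRHS]mulr1 ltr_pM2l//; lra.
have m0 : 0 <= m.
  rewrite /m -lerBlDr sub0r floor_ge_int.
  by rewrite mulrNz -pmulrn natrX.
have mlt : m < (2 ^ k.+1)%:Z.
  rewrite /m expnS mul2n -addnn PoszD ltrD2r floor_lt_int.
  by rewrite -pmulrn natrX.
have ml : (`|m| < 2 ^ k.+1)%N by rewrite -ltz_nat gez0_abs.
exists (Ordinal ml); rewrite /= /cell.
rewrite mulrCA divff ?gt_eqF// mulr1.
have -> : `|m|%:R - 2 ^+ k = (Num.floor (2 ^+ k * x))%:~R :> R.
  rewrite pmulrn gez0_abs// /m intrD -pmulrn natrX addrK//.
by rewrite intrKfloor.
Qed.
End Compactness.

(** * Compactness of the embedding into L^2 *)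

(** A bounded real sequence is almost constant along an ultrafilter. *)
Lemma ultra_bounded_close (R : realType) (U : set_system nat) (a : nat -> R) (B : R) :
  UltraFilter U -> (forall n, `|a n| <= B) -> forall eta, 0 < eta ->
  exists2 A, U A & forall n m, A n -> A m -> `|a n - a m| < eta.
Proof.
move=> UU aB eta eta0.
have : compact `[- B, B] by exact: segment_compact.
move=> /(_ (a @ U) _)[|p [_ clp]].
  rewrite -[_ _]/(U (a @^-1` `[- B, B])) (_ : _ @^-1` _ = setT); first exact: filterT.
  by apply/seteqP; split => // n _; rewrite /= in_itv/= -ler_norml.
have e2 : 0 < eta / 2 by rewrite divr_gt0.
exists (a @^-1` (ball p (eta / 2))).
  have [//|Unot] := in_ultra_setVsetC (a @^-1` (ball p (eta / 2))) UU.
  have [y [/= yn yb]] := clp (~` ball p (eta / 2)) _ Unot (nbhsx_ballx p _ e2).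
  by case: yn.
move=> n m; rewrite /= /ball/= => pn pm.
rewrite (_ : a n - a m = (p - a m) - (p - a n)); last by ring.
by rewrite (le_lt_trans (ler_normB _ _))// [ltRHS]splitr ltrD.
Qed.

Section Compactness.
Context (R : realType).
Notation mu := (@lebesgue_measure R).
Notation mu2 := (mu \x mu)%E.
Notation Om := (`]- 2^-1, 2^-1[%classic : set R).

Lemma incrementB r (u v : R -> R) : increment r (u - v) = increment r u - increment r v.
Proof.
by have := increment_lin r (-1) v u; rewrite !scaleN1r ![- _ + _]addrC.
Qed.

Section Sequence.
Variables (u : nat -> R -> R) (M : R).
Hypotheses (Lu : forall n, L2 mu (u n))
  (u0 : forall n, {ae mu, forall x, ~ Om x -> u n x = 0})
  (Li : forall n, L2 mu2 (increment 1 (u n)))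
  (u1 : forall n, ip mu (u n) (u n) <= 1)
  (iM : forall n, ip mu2 (increment 1 (u n)) (increment 1 (u n)) <= M).

Let subL := L2_subspace mu.
Let symL := ip_sym_bilinear mu.
Let psdL := @ip_ge0 _ _ R mu.

(** Along an ultrafilter all the integrals over dyadic intervals settle at once,
    so no diagonal extraction is needed before the choice of a subsequence. *)
Lemma ultra_L2_close (U : set_system nat) : UltraFilter U -> forall eps, 0 < eps ->
  exists2 A, U A & forall n m, A n -> A m -> ip mu (u n - u m) (u n - u m) <= eps.
Proof.
move=> UU eps eps0.
have M0 : 0 <= M by apply: le_trans (iM 0); apply: Rintegral_ge0 => z _; rewrite -expr2 sqr_ge0.
pose N := Num.bound ((4 * M + 1) / eps).
have NM : 4 * M + 1 < N%:R * eps.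
  by rewrite -ltr_pdivrMr// archi_boundP// divr_ge0 ?(ltW eps0)//; lra.
(* The differences w satisfy 1 + |w| ^ 2 <= 5, and the weights 2 ^ k with k < N
   add up to less than 2 ^ N. *)
pose eta : R := (5 * 2 ^+ N)^-1.
have eta0 : 0 < eta by rewrite invr_gt0 mulr_gt0// exprn_gt0.
pose g k i := cell_indicator k ((i%:R - 2 ^+ k) / 2 ^+ k : R).
have Lg k i : L2 mu (g k i) by exact: L2_cell_indicator.
have bnd k i n : `|ip mu (u n) (g k i)| <= 1 + ip mu (g k i) (g k i).
  have := bil_CS subL symL psdL (Lu n) (Lg k i).
  have := psdL (Lg k i); have := psdL (Lu n); have := u1 n.
  rewrite -(real_normK (num_real (ip mu (u n) (g k i)))).
  move: (normr_ge0 (ip mu (u n) (g k i))).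
  move: `|_| (ip mu (u n) (u n)) (ip mu (g k i) (g k i)) => p q r p0 q1 q0 r0 pqr.
  rewrite leNgt; apply/negP => h; nra.
have sel k i := ultra_bounded_close UU (bnd k i) eta0.
have [A AP] := choice (fun ki : nat * nat => let: ex_intro2 A UA HA := sel ki.1 ki.2 in
  ex_intro (fun A => U A /\ _) A (conj UA HA)).
exists (fun n => forall k : 'I_N, forall i : 'I_(2 ^ k.+1), A (k : nat, i : nat) n).
  apply: filter_forall => k; apply: filter_forall => i; exact: (AP (k : nat, i : nat)).1.
move=> n m An Am; set w := u n - u m.
have Lw : L2 mu w by exact: subspaceB.
have Lwi : L2 mu2 (increment 1 w).
  by rewrite incrementB; exact: (subspaceB (L2_subspace mu2)).
have w0 : {ae mu, forall x, ~ Om x -> w x = 0}.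
  have h := @filterI _ _ (ae_filter_ringOfSetsType mu) _ _ (u0 n) (u0 m).
  apply: (@filterS _ _ (ae_filter_ringOfSetsType mu) _ _ _ h) => x [h1 h2] Omx.
  by rewrite -[w x]/(u n x - u m x) h1// h2// subrr.
have w4 : ip mu w w <= 4.
  have := bil_sub_le subL symL psdL (Lu n) (Lu m).
  have := u1 n; have := u1 m; rewrite -/w; lra.
have wM : ip mu2 (increment 1 w) (increment 1 w) <= 4 * M.
  rewrite incrementB.
  have := bil_sub_le (L2_subspace mu2) (ip_sym_bilinear mu2) (@ip_ge0 _ _ R mu2) (Li n) (Li m).
  have := iM n; have := iM m; lra.
have := dyadic_poincare N Lw Lwi => dp.
have sumle : \sum_(k < N) 2 ^+ k * \int[mu2]_z (w z.1 * w z.2 * cell_kernel k z) <= 1.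
  have leeta (k : 'I_N) : \int[mu2]_z (w z.1 * w z.2 * cell_kernel k z) <= eta * 5.
    apply: (le_trans (@cell_cross_le R k w eta Lw w0 _)); last first.
      by rewrite ler_wpM2l ?(ltW eta0)//; lra.
    move=> x /(@cell_grid R k)[i xi].
    have -> : cell_indicator k x = g k i.
      by apply/funext => y; rewrite /g /cell_indicator /cell_kernel/= xi.
    rewrite (bilBl subL symL)//.
    by apply/ltW; apply: (AP (k : nat, i : nat)).2; [exact: An|exact: Am].
  apply: (@le_trans _ _ (\sum_(k < N) 2 ^+ k * (eta * 5))).
    by apply: ler_sum => k _; rewrite ler_wpM2l ?exprn_ge0.
  rewrite -mulr_suml sum_pow2 /eta.
  have k0 : 0 < 2 ^+ N :> R by rewrite exprn_gt0.
  rewrite invfM mulrAC mulVf ?mul1r// ler_pdivrMr// mul1r; lra.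
have : N%:R * ip mu w w <= N%:R * eps by lra.
rewrite ler_pM2l//.
Qed.

End Sequence.
End Compactness.

Section Compactness.
Context (R : realType).
Notation mu := (@lebesgue_measure R).
Notation mu2 := (mu \x mu)%E.
Notation Om := (`]- 2^-1, 2^-1[%classic : set R).

Section Sequence.
Variables (u : nat -> R -> R) (M : R).
Hypotheses (Hu : forall n, logspace Om (u n))
  (u1 : forall n, ip mu (u n) (u n) <= 1)
  (iM : forall n, ip mu2 (increment 1 (u n)) (increment 1 (u n)) <= M).

Let Lu n : L2 mu (u n). Proof. by have /logspaceP[] := Hu n. Qed.
Let u0 n : {ae mu, forall x, ~ Om x -> u n x = 0}. Proof. by have /logspaceP[] := Hu n. Qed.
Let Li n : L2 mu2 (increment 1 (u n)). Proof. by have /logspaceP[] := Hu n. Qed.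

Lemma fast_subsequence : exists2 phi : nat -> nat, {homo phi : i j / (i < j)%N} &
  forall n k, (k <= n)%N ->
    ip mu (u (phi n) - u (phi k)) (u (phi n) - u (phi k)) <= 8^-1 ^+ k.
Proof.
have [U [UU sU]] := ultraFilterLemma eventually_filter.
have e0 k : 0 < 8^-1 ^+ k :> R by rewrite exprn_gt0.
have close k := ultra_L2_close Lu u0 Li u1 iM UU (e0 k).
have [A AP] := choice (fun k => let: ex_intro2 A UA HA := close k in
  ex_intro (fun A => U A /\ _) A (conj UA HA)).
have pick k N : exists n, (N < n)%N /\ forall j : 'I_k.+1, A j n.
  have UN : U [set n | (N < n)%N] by apply: sU; exists N.+1.
  have UA : U [set n | forall j : 'I_k.+1, A j n].
    by apply: filter_forall => j; exact: (AP j).1.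
  have UI : U ([set n | (N < n)%N] `&` [set n | forall j : 'I_k.+1, A j n]) by exact: filterI.
  by have [n [/= Nn An]] := filter_ex UI; exists n.
have [sel selP] := choice (fun kN : nat * nat => pick kN.1 kN.2).
pose phi := fix phi k := if k is j.+1 then sel (j.+1, phi j) else sel (0%N, 0%N).
have phiS k : (phi k < phi k.+1)%N by exact: (selP (k.+1, phi k)).1.
have phiA k j : (j <= k)%N -> A j (phi k).
  rewrite -ltnS => jk; case: k jk => [|k] jk.
    by have := (selP (0%N, 0%N)).2 (Ordinal jk).
  by have := (selP (k.+1, phi k)).2 (Ordinal jk).
exists phi; first by apply: (homo_ltn ltn_trans).
by move=> n k kn; apply: (AP k).2; apply: phiA.
Qed.

(** The subsequence converges almost everywhere, hence so do its increments, and
    Fatou bounds the increments of the limit. *)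
Lemma log_compactness : exists phi w, [/\ {homo phi : i j / (i < j)%N}, logspace Om w,
  ip mu (u (phi n) - w) (u (phi n) - w) @[n --> \oo] --> (0 : R) &
  forall (c : R ^nat) l,
    (forall n, ip mu2 (increment 1 (u (phi n))) (increment 1 (u (phi n))) <= c n) ->
    c n @[n --> \oo] --> l -> ip mu2 (increment 1 w) (increment 1 w) <= l].
Proof.
have [phi phiS phiC] := fast_subsequence.
have [w [Lw aew cvgw]] := fast_cauchy_L2_limit (fun n => Lu (phi n)) phiC.
have mw := L2_measurable Lw.
have mi (v : R -> R) : measurable_fun setT v -> measurable_fun setT (increment 1 v).
  exact: measurable_increment.
have mu' n := L2_measurable (Lu (phi n)).
have bound (c : R ^nat) l :
    (forall n, ip mu2 (increment 1 (u (phi n))) (increment 1 (u (phi n))) <= c n) ->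
    c n @[n --> \oo] --> l -> (\int[mu2]_z (increment 1 w z ^+ 2)%:E <= l%:E)%E.
  move=> uc cl.
  apply: (@fatou_le _ _ _ mu2 (fun n z => increment 1 (u (phi n)) z ^+ 2) _ c l) => //.
  - by move=> n; apply: measurable_funX; exact: (mi _ (mu' n)).
  - by apply: measurable_funX; exact: (mi _ mw).
  - by move=> n z; rewrite sqr_ge0.
  - by move=> z; rewrite sqr_ge0.
  - have := ae2I (ae_fst aew) (ae_snd aew); apply: ae2S => z [z1 z2].
    have h : increment 1 (u (phi n)) z @[n --> \oo] --> increment 1 w z.
      by apply: cvgM; [exact: cvgB|exact: cvg_cst].
    by rewrite expr2; exact: (cvgM h h).
  - by move=> n; rewrite -ipE// lee_fin.
have Liw : L2 mu2 (increment 1 w).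
  apply/L2P; split; first exact: mi.
  exact: le_lt_trans (bound (fun=> M) M (fun n => iM (phi n)) (@cvg_cst _ _ _ _ _)) (ltry _).
have w0 : {ae mu, forall x, ~ Om x -> w x = 0}.
  have h := @filterI _ _ (ae_filter_ringOfSetsType mu) _ _ aew
    (ae_foralln (fun n => u0 (phi n))).
  apply: (@filterS _ _ (ae_filter_ringOfSetsType mu) _ _ _ h) => x [xw x0] Omx.
  apply/esym/(@cst_cvg_eq R 0); move: xw.
  by have -> : (fun n => u (phi n) x) = (fun=> 0) by apply/funext => n; exact: x0.
exists phi, w; split => //; first by apply/logspaceP.
by move=> c l uc cl; rewrite -lee_fin ipE// (bound c).
Qed.

End Sequence.
End Compactness.

(** * The form on the interval of length one *)

Section LogSpace.
Context (R : realType).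
Notation mu := (@lebesgue_measure R).
Notation mu2 := (mu \x mu)%E.

Lemma logspace_subspace (Om : set R) : lin_subspace (logspace Om).
Proof.
have subL := L2_subspace mu; have subL2 := L2_subspace mu2.
split.
  apply/logspaceP; split; [exact: subspace0 subL|by apply: aeW|].
  have -> : increment 1 (0 : R -> R) = 0.
    by apply/funext => z; rewrite /increment subrr mul0r.
  exact: subspace0 subL2.
move=> a u v /logspaceP[Lu u0 ui] /logspaceP[Lv v0 vi]; apply/logspaceP; split.
- exact: subspaceP.
- have h := @filterI _ _ (ae_filter_ringOfSetsType mu) _ _ u0 v0.
  apply: (@filterS _ _ (ae_filter_ringOfSetsType mu) _ _ _ h) => x [ux vx] Omx.
  by rewrite -[LHS]/(a * u x + v x) ux// vx// mulr0 addr0.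
- by rewrite increment_lin; exact: subspaceP.
Qed.

Notation Om := (`]- 2^-1, 2^-1[%classic : set R).

Lemma log_form_unitE u v : logspace Om u -> logspace Om v ->
  log_form u v = 2^-1 * ip mu2 (increment 1 u) (increment 1 v) + rho1 * ip mu u v.
Proof.
have h : 0 < 2^-1 :> R by [].
have e : 2 * 2^-1 = 1 :> R by rewrite divff.
by move=> Du Dv; rewrite (log_formE h Du Dv) e ln1 mulr0 subr0.
Qed.

Lemma logspace_L2 (Om : set R) u : logspace Om u -> L2 mu u.
Proof. by move=> /logspaceP[]. Qed.

Lemma logspace_increment (Om : set R) u : logspace Om u -> L2 mu2 (increment 1 u).
Proof. by move=> /logspaceP[]. Qed.

Lemma ip_sym_bilinear_logspace (Om : set R) : sym_bilinear (logspace Om) (ip mu).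
Proof.
have [h1 h2] := ip_sym_bilinear mu.
split=> [u v Du Dv|a u v w Du Dv Dw]; first by apply: h1; exact: (@logspace_L2 Om).
by apply: h2; exact: (@logspace_L2 Om).
Qed.

Lemma log_form_sym_bilinear : sym_bilinear (logspace Om) (@log_form R).
Proof.
have [h1 h2] := ip_sym_bilinear_logspace Om; have [k1 k2] := ip_sym_bilinear mu2.
split=> [u v Du Dv|a u v w Du Dv Dw].
  by rewrite !log_form_unitE// h1// k1//; exact: (@logspace_increment Om).
have Duv := subspaceP (logspace_subspace Om) a Du Dv.
rewrite !log_form_unitE// increment_lin h2// k2; try exact: (@logspace_increment Om).
ring.
Qed.

Lemma log_form_lower u : logspace Om u -> - `|rho1 : R| * ip mu u u <= log_form u u.
Proof.
move=> Du; rewrite log_form_unitE// mulNr lerNl opprD.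
have := ip_ge0 (logspace_L2 Du); have := ip_ge0 (logspace_increment Du).
have := ler_norm (- rho1 : R); rewrite normrN => h i0 u0.
have := ler_wpM2r u0 h; lra.
Qed.

Lemma log_form_compact (u : nat -> R -> R) (M : R) :
  (forall n, logspace Om (u n)) -> (forall n, ip mu (u n) (u n) <= 1) ->
  (forall n, log_form (u n) (u n) <= M) ->
  exists phi : nat -> nat, exists w, [/\ {homo phi : i j / (i < j)%N}, logspace Om w,
    ip mu (u (phi n) - w) (u (phi n) - w) @[n --> \oo] --> (0 : R) &
    forall l, log_form (u n) (u n) @[n --> \oo] --> l -> log_form w w <= l].
Proof.
move=> Du u1 uM.
have iE n : ip mu2 (increment 1 (u n)) (increment 1 (u n)) =
    2 * (log_form (u n) (u n) - rho1 * ip mu (u n) (u n)).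
  by rewrite log_form_unitE//; lra.
have iM n : ip mu2 (increment 1 (u n)) (increment 1 (u n)) <= 2 * (M + `|rho1|).
  rewrite iE ler_wpM2l// lerD//.
  have b0 := ip_ge0 (logspace_L2 (Du n)).
  have h1 : - `|rho1| <= rho1 :> R by rewrite lerNl -normrN ler_norm.
  have h2 := ler_wpM2r b0 h1; have h3 := u1 n.
  have h4 := ler_wpM2l (normr_ge0 (rho1 : R)) h3.
  lra.
have [phi [w [phiS Dw cvgw semi]]] := log_compactness Du u1 iM.
exists phi, w; split => // l ul.
have cvgb := cvg_bil_diag (logspace_subspace Om) (ip_sym_bilinear_logspace Om)
  (fun v Dv => ip_ge0 (logspace_L2 Dv)) (fun n => Du (phi n)) Dw (fun n => u1 (phi n)) cvgw.
have phiy : phi n @[n --> \oo] --> \oo.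
  have nphi n : (n <= phi n)%N.
    by elim: n => // n IH; apply: (leq_ltn_trans IH); exact: phiS.
  by apply/cvgnyPge => N; exists N => // n /= Nn; exact: leq_trans (nphi n).
have ulphi : log_form (u (phi n)) (u (phi n)) @[n --> \oo] --> l.
  exact: (cvg_comp _ _ phiy ul).
have := semi (fun n => 2 * (log_form (u (phi n)) (u (phi n)) -
   rho1 * ip mu (u (phi n)) (u (phi n)))) (2 * (l - rho1 * ip mu w w)).
move=> /(_ (fun n => _)) h.
rewrite log_form_unitE//.
have : ip mu2 (increment 1 w) (increment 1 w) <= 2 * (l - rho1 * ip mu w w).
  apply: h; first by move=> n; rewrite iE.
  apply: cvgM; first exact: cvg_cst.
  by apply: cvgB => //; apply: cvgM => //; exact: cvg_cst.
lra.
Qed.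
End LogSpace.

(** * Simplicity of the lowest eigenvalue *)

Section Simplicity.
Context (R : realType).
Notation mu := (@lebesgue_measure R).
Notation mu2 := (mu \x mu)%E.
Notation Om := (`]- 2^-1, 2^-1[%classic : set R).

Definition absf (u : R -> R) x := `|u x|.

Lemma increment_abs_le r u z : increment r (absf u) z ^+ 2 <= increment r u z ^+ 2.
Proof.
rewrite !increment_sqr ler_wpM2r ?near_kernel_ge0// /absf.
by rewrite -[leLHS]real_normK ?num_real// -[leRHS]real_normK ?num_real// ler_sqr ?nnegrE//
  ler_dist_dist.
Qed.

Lemma logspace_abs (Om' : set R) u : logspace Om' u -> logspace Om' (absf u).
Proof.
move=> /logspaceP[Lu u0 ui]; have mu' := L2_measurable Lu.
have mabs : measurable_fun setT (absf u) by exact: measurableT_comp.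
apply/logspaceP; split.
- by apply: (@L2_le _ _ _ mu u (absf u)) => // x; rewrite normr_id.
- apply: (@filterS _ _ (ae_filter_ringOfSetsType mu) _ _ _ u0) => x ux Omx.
  by rewrite /absf ux// normr0.
- apply/L2P; split; first exact: measurable_increment.
  apply: le_lt_trans (L2_int ui); apply: ge0_le_integral => //.
  + by move=> z _; rewrite lee_fin sqr_ge0.
  + by apply/measurable_EFinP/measurable_funX; exact: measurable_increment.
  + by apply/measurable_EFinP/measurable_funX; exact: measurable_increment.
  + by move=> z _; rewrite lee_fin increment_abs_le.
Qed.

Lemma ae_product_null (P Q : set R) : measurable P -> measurable Q ->
  {ae mu2, forall z : R * R, ~ (P z.1 /\ Q z.2)} -> mu P = 0%E \/ mu Q = 0%E.
Proof.
move=> mP mQ [N [mN N0 PQ]].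
have : mu2 (P `*` Q) = 0%E.
  apply: (subset_measure0 _ mN _ N0); first exact: measurableX.
  by move=> z [Pz Qz]; apply: PQ => /= h; exact: h.
rewrite product_measure1E// => /eqP; rewrite mule_eq0 => /orP[] /eqP; [left|right]; done.
Qed.

(** Replacing u by its absolute value keeps the L^2 norm and strictly lowers
    the form as soon as u takes values of both signs, because any two points of
    the interval interact. *)
Lemma minimizer_sign u l : logspace Om u ->
  (forall v, logspace Om v -> l * ip mu v v <= log_form v v) ->
  log_form u u = l * ip mu u u ->
  exists2 s : R, s ^+ 2 = 1 & {ae mu, forall x, 0 <= s * u x}.
Proof.
move=> Du lmin ul; have Da := logspace_abs Du.
have [Lu u0 ui] := (logspaceP Om u).1 Du.
have mu' := L2_measurable Lu.
have La := logspace_increment Da.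
have ipa : ip mu (absf u) (absf u) = ip mu u u.
  by congr Rintegral; apply/funext => x; rewrite /absf -!expr2 real_normK ?num_real.
have := lmin _ Da; rewrite ipa -ul !log_form_unitE// ipa lerD2r ler_pM2l// => le1.
pose f z := increment 1 u z ^+ 2 - increment 1 (absf u) z ^+ 2.
have f0 z : 0 <= f z by rewrite subr_ge0 increment_abs_le.
have i1 := L2_integrableM ui ui; have i2 := L2_integrableM La La.
have if_ : mu2.-integrable setT (EFin \o f) by exact: (integrableB measurableT i1 i2).
have intf : \int[mu2]_z f z = 0.
  have ef : \int[mu2]_z f z = ip mu2 (increment 1 u) (increment 1 u) -
      ip mu2 (increment 1 (absf u)) (increment 1 (absf u)).
    by rewrite -RintegralB//; congr Rintegral.
  apply/eqP; rewrite ef subr_eq0 eq_le le1 -subr_ge0 -ef.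
  by apply: Rintegral_ge0 => z _; exact: f0.
have f0ae := Rintegral_eq0_ae if_ f0 intf.
have sep : {ae mu2, forall z : R * R, ~ (0 < u z.1 /\ u z.2 < 0)}.
  apply: (ae2S _ (ae2I f0ae (ae_close_supports u0 u0))) => z [fz close] [z1 z2].
  have z12 : z.1 != z.2 by apply/eqP => e; move: z1 z2; rewrite e; lra.
  have zle : `|z.1 - z.2| <= 1.
    rewrite -[leRHS](@divff _ 2)// ltW//; apply: close.
    by rewrite mulf_neq0 ?(gt_eqF z1) ?(lt_eqF z2).
  have k0 : 0 < near_kernel 1 z.
    by rewrite /near_kernel zle mul1r invr_gt0 normr_gt0 subr_eq0.
  move: fz; rewrite /f /= !increment_sqr -mulrBl => /eqP.
  rewrite mulf_eq0 (gt_eqF k0) orbF /absf (gtr0_norm z1) (ltr0_norm z2) => /eqP.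
  have : 0 < u z.1 * - u z.2 by rewrite mulr_gt0// oppr_gt0.
  lra.
have mP : measurable [set x | 0 < u x].
  rewrite (_ : [set x | _] = u @^-1` `]0, +oo[); last first.
    by apply/seteqP; split => x /=; rewrite in_itv/= andbT.
  by rewrite -[_ @^-1` _]setTI; apply: mu'.
have mN : measurable [set x | u x < 0].
  rewrite (_ : [set x | _] = u @^-1` `]-oo, 0[); last first.
    by apply/seteqP; split => x /=; rewrite in_itv.
  by rewrite -[_ @^-1` _]setTI; apply: mu'.
have [P0|N0] := ae_product_null mP mN sep.
- exists (-1); first by rewrite sqrrN expr1n.
  by exists [set x | 0 < u x]; split => // x /=; rewrite mulN1r oppr_ge0 => /negP; rewrite -ltNge.
- exists 1; first by rewrite expr1n.
  by exists [set x | u x < 0]; split => // x /=; rewrite mul1r => /negP; rewrite -ltNge.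
Qed.

Lemma ip_ae_ge0 u v : L2 mu u -> L2 mu v -> {ae mu, forall x, 0 <= u x} ->
  {ae mu, forall x, 0 <= v x} -> 0 <= ip mu u v.
Proof.
move=> Lu Lv u0 v0.
have [mu' mv] := (L2_measurable Lu, L2_measurable Lv).
have -> : ip mu u v = \int[mu]_x `|u x * v x|.
  apply: eq_ae_Rintegral; first exact: measurable_funM.
    by apply: measurableT_comp => //; exact: measurable_funM.
  have h := @filterI _ _ (ae_filter_ringOfSetsType mu) _ _ u0 v0.
  apply: (@filterS _ _ (ae_filter_ringOfSetsType mu) _ _ _ h) => x [ux vx].
  by rewrite ger0_norm// mulr_ge0.
exact: Rintegral_ge0.
Qed.

(** Make e0 and e1 nonnegative by a change of sign.  Their difference w is again
    a minimiser, so it has a sign; but its products with e0 and e1 are 1 and -1. *)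
Lemma bottom_simple (e0 e1 : R -> R) l : logspace Om e0 -> logspace Om e1 ->
  ip mu e0 e0 = 1 -> ip mu e1 e1 = 1 -> ip mu e0 e1 = 0 ->
  (forall v, logspace Om v -> log_form e0 v = l * ip mu e0 v) ->
  (forall v, logspace Om v -> log_form e1 v = l * ip mu e1 v) ->
  (forall v, logspace Om v -> l * ip mu v v <= log_form v v) -> False.
Proof.
move=> D0 D1 b00 b11 b01 E0 E1 lmin.
have subD := logspace_subspace Om; have symb := ip_sym_bilinear_logspace Om.
have symE := @log_form_sym_bilinear R.
have [s0 s02 h0] : exists2 s : R, s ^+ 2 = 1 & {ae mu, forall x, 0 <= s * e0 x}.
  by apply: (@minimizer_sign _ l) => //; exact: E0.
have [s1 s12 h1] : exists2 s : R, s ^+ 2 = 1 & {ae mu, forall x, 0 <= s * e1 x}.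
  by apply: (@minimizer_sign _ l) => //; exact: E1.
pose w := s0 *: e0 - s1 *: e1.
have Ds0 : logspace Om (s0 *: e0) by exact: subspaceZ.
have Ds1 : logspace Om (s1 *: e1) by exact: subspaceZ.
have Dw : logspace Om w by exact: subspaceB.
have Ew v : logspace Om v -> log_form w v = l * ip mu w v.
  move=> Dv; rewrite (bilBl subD symE)// (bilBl subD symb)//.
  by rewrite !(bilZl subD symE)// !(bilZl subD symb)// E0// E1//; ring.
have [s s2 hs] : exists2 s : R, s ^+ 2 = 1 & {ae mu, forall x, 0 <= s * w x}.
  by apply: (@minimizer_sign _ l) => //; exact: Ew.
have Dsw : logspace Om (s *: w) by exact: subspaceZ.
have L (v : R -> R) (Dv : logspace Om v) : L2 mu v := logspace_L2 Dv.
have p0 : 0 <= ip mu (s *: w) (s0 *: e0) by apply: ip_ae_ge0 => //; exact: L.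
have p1 : 0 <= ip mu (s *: w) (s1 *: e1) by apply: ip_ae_ge0 => //; exact: L.
move: p0 p1.
rewrite !(bilZl subD symb)// !(bilBl subD symb)// !(bilZl subD symb)// !(bilZr subD symb)//.
rewrite b00 b11 b01 [ip mu e1 e0](bilC symb)// b01.
rewrite !mulr0 !mulr1 subr0 sub0r -!expr2 s02 s12 mulr1 mulrN1 oppr_ge0 => p0 p1.
have s0E : s = 0 by apply/eqP; rewrite eq_le p0 p1.
by move: s2; rewrite s0E expr0n => /eqP; rewrite eq_sym oner_eq0.
Qed.

End Simplicity.

(** * Infinitely many orthogonal elements *)

Section Tents.
Context (R : realType).
Notation mu := (@lebesgue_measure R).
Notation mu2 := (mu \x mu)%E.
Notation Om := (`]- 2^-1, 2^-1[%classic : set R).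

Definition tent (p q x : R) : R := Num.max 0 (Num.min (x - p) (q - x)).

Lemma tent_ge0 p q x : 0 <= tent p q x.
Proof. by rewrite /tent le_max lexx. Qed.

Lemma tent_gt0 p q x : (0 < tent p q x) = (p < x < q).
Proof. by rewrite /tent lt_max ltxx lt_min !subr_gt0. Qed.

Lemma tent_eq0 p q x : ~~ (p < x < q) -> tent p q x = 0.
Proof. by rewrite -tent_gt0 -leNgt => h; apply/eqP; rewrite eq_le h tent_ge0. Qed.

Lemma tent_lipschitz p q x y : `|tent p q x - tent p q y| <= `|x - y|.
Proof.
have h a b : tent p q a - tent p q b <= `|a - b|.
  have h1 := ler_norm (a - b); have h2 : b - a <= `|a - b| by rewrite distrC ler_norm.
  rewrite lerBlDr {1}/tent ge_max addr_ge0 ?tent_ge0//= ge_min.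
  have : Num.min (b - p) (q - b) <= tent p q b by rewrite /tent le_max lexx orbT.
  by rewrite ge_min => /orP[] h; apply/orP; [left|right]; lra.
by rewrite ler_norml h lerNl opprB distrC h.
Qed.

Lemma measurable_tent p q : measurable_fun setT (tent p q).
Proof.
by apply: measurable_maxr => //; apply: measurable_minr; apply: measurable_funB.
Qed.

(** A 1-Lipschitz function has (u x - u y) ^ 2 / |x - y| <= 1 for |x - y| <= 1, and
    this vanishes unless x or y lies in the interval, hence off a bounded square. *)
Lemma logspace_tent p q : - 2^-1 <= p -> q <= 2^-1 -> logspace Om (tent p q).
Proof.
move=> p1 q1; have mt := measurable_tent p q.
have supp x : tent p q x != 0 -> - 2^-1 < x < 2^-1.
  by apply: contraNT => h; apply/eqP/tent_eq0; apply: contraNN h => /andP[h1 h2]; apply/andP; split; lra.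
pose S := `[- 2, 2]%classic : set R.
have mS : measurable S by exact: measurable_itv.
have muS : (mu S < +oo)%E.
  by rewrite /S lebesgue_measure_itv/=; case: ifP => _; rewrite -?EFinB ltry.
have tent1 x : tent p q x <= 1.
  have [h|h] := boolP (p < x < q); last by rewrite tent_eq0.
  by rewrite /tent ge_max ler01 ge_min; apply/orP; left; lra.
apply/logspaceP; split.
- apply/L2P; split => //.
  apply: (@le_lt_trans _ _ (\int[mu]_x (\1_S x)%:E)%E).
    apply: ge0_le_integral => //.
    + by move=> x _; rewrite lee_fin sqr_ge0.
    + exact/measurable_EFinP/measurable_funX.
    + by apply/measurable_EFinP; exact: measurable_indic.
    + move=> x _; rewrite lee_fin indicE.
      have [h|/supp h] := eqVneq (tent p q x) 0; first by rewrite h expr0n/=.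
      rewrite mem_set/=; last by rewrite /S/= in_itv/=; lra.
      by rewrite expr_le1 ?tent_ge0.
  by rewrite integral_indic//= setIT.
- apply: aeW => x Omx; apply: tent_eq0; apply/negP => h; apply: Omx.
  by rewrite /= in_itv/=; lra.
- apply/L2P; split; first exact: measurable_increment.
  apply: (@le_lt_trans _ _ (\int[mu2]_z (\1_(S `*` S) z)%:E)%E).
    apply: ge0_le_integral => //.
    + by move=> z _; rewrite lee_fin sqr_ge0.
    + by apply/measurable_EFinP/measurable_funX; exact: measurable_increment.
    + by apply/measurable_EFinP; apply: measurable_indic; exact: measurableX.
    + move=> z _; rewrite lee_fin increment_sqr indicE.
      rewrite /near_kernel; case: (leP `|z.1 - z.2| 1) => [z1|z1]; last first.
        by rewrite mul0r mulr0.
      have [h|h] := eqVneq (tent p q z.1 - tent p q z.2) 0.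
        by rewrite h expr0n mul0r.
      rewrite mem_set/=; last first.
        have [h1|/supp h1] := eqVneq (tent p q z.1) 0.
          have /supp h2 : tent p q z.2 != 0.
            by apply: contraNN h => /eqP ->; rewrite h1 subrr.
          by rewrite /S/= !in_itv/=; move: z1; rewrite ler_norml; lra.
        by rewrite /S/= !in_itv/=; move: z1; rewrite ler_norml; lra.
      have z0 : 0 < `|z.1 - z.2|.
        by apply: lt_le_trans (tent_lipschitz p q z.1 z.2); rewrite normr_gt0.
      rewrite mul1r ler_pdivrMr// mul1r -(real_normK (num_real (_ - _))).
      have := tent_lipschitz p q z.1 z.2; move: (normr_ge0 (tent p q z.1 - tent p q z.2)).
      move: `|_ - _| `|z.1 - _| z1 z0 => s t t1 t0 s0 st.
      by rewrite expr2; nra.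
  rewrite integral_indic//=; last exact: measurableX.
  by rewrite setIT product_measure1E// lte_mul_pinfty// ge0_fin_numE.
Qed.

Definition tents (n : nat) : R -> R := tent (n.+3%:R^-1) (n.+2%:R^-1).

Lemma logspace_tents n : logspace Om (tents n).
Proof.
apply: logspace_tent.
  by rewrite (@le_trans _ _ 0)// ?invr_ge0// oppr_le0 invr_ge0.
by rewrite lef_pV2 ?posrE ?ltr0n// ler_nat.
Qed.

Lemma tents_ortho i j : i != j -> ip mu (tents i) (tents j) = 0.
Proof.
move=> ij; rewrite /ip -[RHS](mul0r (fine (mu setT))) -Rintegral_cst//.
congr Rintegral; apply/funext => x.
wlog ij' : i j ij / (i < j)%N.
  move=> H; move: (ij); rewrite neq_ltn => /orP[|] h; first exact: H.
  by rewrite mulrC H// eq_sym.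
have le : j.+2%:R^-1 <= i.+3%:R^-1 :> R by rewrite lef_pV2 ?posrE ?ltr0n// ler_nat !ltnS.
have [h|h] := boolP (i.+3%:R^-1 < x < i.+2%:R^-1); last by rewrite /tents tent_eq0// mul0r.
rewrite [tents j x]tent_eq0 ?mulr0//.
by apply/negP => /andP[_ h2]; move: h => /andP[h1 _];
  have := lt_le_trans h2 (le_trans le (ltW h1)); rewrite ltxx.
Qed.

Lemma tents_gt0 i : 0 < ip mu (tents i) (tents i).
Proof.
have Lt := logspace_L2 (logspace_tents i).
rewrite lt_def ip_ge0// andbT; apply/eqP => /(ip_eq0 Lt) [N [mN N0 sN]].
pose A := `]i.+3%:R^-1, i.+2%:R^-1[%classic : set R.
have : mu A = 0%E.
  apply: (subset_measure0 _ mN _ N0); first exact: measurable_itv.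
  move=> x; rewrite /A/= in_itv/= => h; apply: sN => /=.
  by apply/eqP; rewrite gt_eqF// /tents tent_gt0.
rewrite /A lebesgue_measure_itv/= lte_fin ltf_pV2 ?posrE ?ltr0n// ltr_nat ltnSn.
move=> /eqP; rewrite -EFinB eqe subr_eq0 => /eqP h.
have : i.+3%:R^-1 < i.+2%:R^-1 :> R by rewrite ltf_pV2 ?posrE ?ltr0n// ltr_nat.
by rewrite h ltxx.
Qed.

End Tents.

(** * Dilations *)

Section Dilation.
Context (R : realType).
Notation mu := (@lebesgue_measure R).
Notation mu2 := (mu \x mu)%E.

Section OneDim.
Variables (s : R) (s0 : 0 < s).

Let phi (x : measurableTypeR R) : measurableTypeR R := x / s.

Let mphi : measurable_fun setT phi.
Proof. exact: measurable_funM. Qed.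

(** Both sides agree on half-open intervals, which determine the measure. *)
Lemma lebesgue_measure_dilation A : measurable A ->
  mu (phi @^-1` A) = (s%:E * mu A)%E.
Proof.
move=> mA; have si0 : 0 <= s^-1 by rewrite invr_ge0 ltW.
pose nu := measure_function_pushforward__canonical__measure_function_Measure mu mphi.
have -> : mu A = mscale (NngNum si0) nu A.
  apply: lebesgue_measure_unique => // _ [[a b] _ <-].
  rewrite [RHS](_ : _ = (s^-1%:E * mu (phi @^-1` `]a, b]%classic))%E)//.
  have -> : phi @^-1` `]a, b]%classic = `]s * a, s * b]%classic.
    apply/seteqP; split => x; rewrite /phi/= !in_itv/= ltr_pdivlMr// ler_pdivrMr//.
      by rewrite ![_ * s]mulrC.
    by rewrite ![_ * s]mulrC.
  rewrite !lebesgue_measure_itv/= !lte_fin ltr_pM2l//.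
  case: ifP => _; rewrite ?mule0// -!EFinB -EFinM -mulrBr mulrA mulVf ?mul1r// gt_eqF//.
by rewrite /mscale/= /pushforward muleA -EFinM divff ?mul1e// gt_eqF.
Qed.

Lemma ge0_integral_dilation (f : R -> \bar R) : measurable_fun setT f ->
  (forall x, 0 <= f x)%E -> (\int[mu]_x f (x / s)%R = s%:E * \int[mu]_x f x)%E.
Proof.
move=> mf f0.
have E : (\int[pushforward mu phi]_x f x = \int[mu]_x f (phi x))%E.
  by rewrite ge0_integral_pushforward//= => x _.
rewrite -[LHS]E.
rewrite -(ge0_integral_mscale mu measurableT (NngNum (ltW s0)))//.
apply: eq_measure_integral => A mA _.
exact: lebesgue_measure_dilation mA.
Qed.

End OneDim.

Definition dil (s : R) (u : R -> R) (x : R) : R := u (x / s).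

Lemma dil_lin s a u v : dil s (a *: u + v) = a *: dil s u + dil s v.
Proof. by []. Qed.

Lemma dilVK s : s != 0 -> cancel (dil s^-1) (dil s).
Proof. by move=> s0 u; apply/funext => x; rewrite /dil invrK divfK. Qed.

Section Scale.
Variables (s : R) (s0 : 0 < s).

Lemma ge0_integral_dilation2 (f : R * R -> \bar R) : measurable_fun setT f ->
  (forall z, 0 <= f z)%E ->
  (\int[mu2]_z f (z.1 / s, z.2 / s)%R = (s ^+ 2)%:E * \int[mu2]_z f z)%E.
Proof.
move=> mf f0.
have mdiv : measurable_fun setT (fun x : R => x / s) by exact: measurable_funM.
rewrite [in RHS]fubini_tonelli1// fubini_tonelli1//=; last first.
  apply: (measurableT_comp mf); apply: measurable_fun_pair.
    exact: (measurableT_comp mdiv).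
  exact: (measurableT_comp mdiv).
have mF := measurable_fun_fubini_tonelli_F (m2 := mu) f mf f0.
have inner x : (\int[mu]_y f (x / s, y / s)%R = s%:E * fubini_F mu f (x / s)%R)%E.
  apply: (@ge0_integral_dilation s s0 (fun y => f ((x / s)%R, y))) => //.
  exact: (measurableT_comp mf (measurable_pair1 _)).
rewrite (@eq_integral _ _ R mu setT (fun x : R => s%:E * fubini_F mu f (x / s)%R)%E); last first.
  by move=> x _; exact: inner.
have mFs : measurable_fun setT (fun x : measurableTypeR R => fubini_F mu f (x / s)%R).
  exact: (measurableT_comp mF mdiv).
have F0 (x : R) : (0 <= fubini_F mu f x)%E by apply: integral_ge0 => y _; exact: f0.
have s0E : (0 <= s%:E)%E by rewrite lee_fin ltW.
rewrite (ge0_integralZl mu measurableT mFs (fun x _ => F0 (x / s)) s0E).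
by have /= -> := ge0_integral_dilation s0 mF F0; rewrite muleA -EFinM.
Qed.

Lemma measurable_dil u : measurable_fun setT u -> measurable_fun setT (dil s u).
Proof. by move=> mu'; apply: (measurableT_comp mu'); exact: measurable_funM. Qed.

Lemma integral_dil_sqr u : measurable_fun setT u ->
  (\int[mu]_x (dil s u x ^+ 2)%:E = s%:E * \int[mu]_x (u x ^+ 2)%:E)%E.
Proof.
move=> mu'; apply: (@ge0_integral_dilation s s0 (fun x => (u x ^+ 2)%:E)).
- exact/measurable_EFinP/measurable_funX.
- by move=> x; rewrite lee_fin sqr_ge0.
Qed.

Lemma L2_dil u : L2 mu u -> L2 mu (dil s u).
Proof.
move=> /L2P[mu' ui]; apply/L2P; split; first exact: measurable_dil.
by rewrite integral_dil_sqr// lte_mul_pinfty// lee_fin ltW.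
Qed.

Lemma ip_dil_diag u : L2 mu u -> ip mu (dil s u) (dil s u) = s * ip mu u u.
Proof.
move=> Lu; apply: EFin_inj; rewrite EFinM !ipE//; last exact: L2_dil.
by apply: integral_dil_sqr; exact: L2_measurable Lu.
Qed.

(** Homogeneity of degree -1 of the kernel: radius and distances scale together. *)
Lemma increment_dil_sqr r u z :
  increment (s * r) (dil s u) z ^+ 2 = s^-1 * increment r u (z.1 / s, z.2 / s) ^+ 2.
Proof.
rewrite !increment_sqr /dil /near_kernel/= -mulrBl normrM normfV (gtr0_norm s0).
rewrite ler_pdivrMr// [r * s]mulrC invfM invrK.
by rewrite -[LHS]mul1r -[X in X * _](@mulVf _ s) ?gt_eqF//; ring.
Qed.

Lemma L2_increment_dil r u : L2 mu u -> L2 mu2 (increment r u) ->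
  L2 mu2 (increment (s * r) (dil s u)) /\
  ip mu2 (increment (s * r) (dil s u)) (increment (s * r) (dil s u)) =
    s * ip mu2 (increment r u) (increment r u).
Proof.
move=> Lu Li; have mu' := L2_measurable Lu.
have mi : measurable_fun setT (fun z => (increment r u z ^+ 2)%:E).
  by apply/measurable_EFinP/measurable_funX; exact: measurable_increment.
have E : (\int[mu2]_z (increment (s * r) (dil s u) z ^+ 2)%:E =
    s%:E * \int[mu2]_z (increment r u z ^+ 2)%:E)%E.
  under eq_integral do rewrite increment_dil_sqr EFinM.
  rewrite ge0_integralZl//; last 3 first.
  - apply: (measurableT_comp mi); apply: measurable_fun_pair.
      by apply: measurable_funM => //; exact: measurable_fst.
    by apply: measurable_funM => //; exact: measurable_snd.
  - by move=> z _; rewrite lee_fin sqr_ge0.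
  - by rewrite lee_fin invr_ge0 ltW.
  have f0 z : (0 <= (increment r u z ^+ 2)%:E)%E by rewrite lee_fin sqr_ge0.
  have /= -> := ge0_integral_dilation2 mi f0.
  by rewrite muleA -EFinM expr2 mulKf// gt_eqF.
have Ldi : L2 mu2 (increment (s * r) (dil s u)).
  apply/L2P; split; first by apply: measurable_increment; exact: measurable_dil.
  by rewrite E lte_mul_pinfty ?lee_fin ?ltW//; exact: L2_int.
split => //; apply: EFin_inj; rewrite EFinM !ipE//.
Qed.

Lemma ae_dil (P : R -> Prop) : {ae mu, forall x, P x} -> {ae mu, forall x, P (x / s)}.
Proof.
move=> [N [mN N0 PN]]; exists ((fun x => x / s) @^-1` N); split.
- rewrite -[_ @^-1` _]setTI.
  by apply: (measurable_funM (measurable_id (D := setT)) (measurable_cst s^-1)).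
- by have := lebesgue_measure_dilation s0 mN; rewrite N0 mule0.
- by move=> x /= nP; exact: PN.
Qed.

End Scale.
End Dilation.

(** Reduces changes of variables in products to changes of variables in squares,
    where the integrands are nonnegative. *)
Lemma polarization (R : realType) (V W : lmodType R) (D : set V) (D' : set W)
    (b : V -> V -> R) (b' : W -> W -> R) (f : V -> W) (s : R) :
  lin_subspace D -> sym_bilinear D b -> lin_subspace D' -> sym_bilinear D' b' ->
  (forall u, D u -> D' (f u)) ->
  (forall a u v, f (a *: u + v) = a *: f u + f v) ->
  (forall u, D u -> b' (f u) (f u) = s * b u u) ->
  forall u v, D u -> D v -> b' (f u) (f v) = s * b u v.
Proof.
move=> subD symb subD' symb' Df flin fb u v Du Dv.
have fD : f (u + 1 *: v) = f u + 1 *: f v.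
  by rewrite addrC flin addrC.
have := fb _ (subspaceD subD Du (subspaceZ subD 1 Dv)).
rewrite fD (bil_quad subD' symb' _ (Df _ Du) (Df _ Dv)) (bil_quad subD symb)// !fb//.
by lra.
Qed.

Section EigenspaceDilation.
Context (R : realType).
Notation mu := (@lebesgue_measure R).
Notation mu2 := (mu \x mu)%E.

Lemma L2_increment_any (a b : R) u : 0 < a -> 0 < b -> L2 mu u ->
  L2 mu2 (increment a u) -> L2 mu2 (increment b u).
Proof.
move=> a0 b0 Lu; have [ab|/ltW ba] := leP a b.
  by move/(increment_radius a0 ab Lu).
by move/(increment_radius b0 ba Lu).
Qed.

Lemma logspace_dil (s a : R) u : 0 < s -> logspace `]- a, a[ u ->
  logspace `]- (s * a), s * a[ (dil s u).
Proof.
move=> s0 /logspaceP[Lu u0 ui]; apply/logspaceP; split.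
- exact: L2_dil.
- apply: (@filterS _ _ (ae_filter_ringOfSetsType mu) _ _ _ (ae_dil s0 u0)) => x h Omx.
  apply: h => xs; apply: Omx; move: xs; rewrite /= !in_itv/= ltr_pdivlMr// ltr_pdivrMr//.
  by rewrite mulNr ![a * s]mulrC.
- have [Li _] := L2_increment_dil s0 Lu ui.
  by apply: (@L2_increment_any (s * 1) 1) => //; [rewrite mulr1|exact: L2_dil].
Qed.

Lemma ip_dil s u v : 0 < s -> L2 mu u -> L2 mu v ->
  ip mu (dil s u) (dil s v) = s * ip mu u v.
Proof.
move=> s0; apply: (polarization (L2_subspace mu) (ip_sym_bilinear mu)
  (L2_subspace mu) (ip_sym_bilinear mu)) => //.
- by move=> w; exact: L2_dil.
- by move=> w; exact: ip_dil_diag.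
Qed.

Lemma ip_increment_dil s u v : 0 < s -> L2 mu u -> L2 mu v ->
  L2 mu2 (increment 1 u) -> L2 mu2 (increment 1 v) ->
  ip mu2 (increment s (dil s u)) (increment s (dil s v)) =
    s * ip mu2 (increment 1 u) (increment 1 v).
Proof.
move=> s0 Lu Lv Liu Liv.
pose D w := L2 mu w /\ L2 mu2 (increment 1 w).
have subD : lin_subspace D.
  have [z l] := L2_subspace mu; have [z2 l2] := L2_subspace mu2.
  split=> [|a w w' [h1 h2] [h3 h4]]; split => //.
  - have -> // : increment 1 (0 : R -> R) = 0.
      by apply/funext => w; rewrite /increment subrr mul0r.
  - exact: l.
  - by rewrite increment_lin; exact: l2.
have symD : sym_bilinear D (fun w w' => ip mu2 (increment 1 w) (increment 1 w')).
  have [k1 k2] := ip_sym_bilinear mu2.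
  split=> [w w' [_ h] [_ h']|a w w' w'' [_ h] [_ h'] [_ h'']]; first exact: k1.
  by rewrite increment_lin k2.
apply: (polarization subD symD (L2_subspace mu2) (ip_sym_bilinear mu2)
  (f := fun w => increment s (dil s w))) => //.
- by move=> w [Lw /(L2_increment_dil s0 Lw)[]]; rewrite mulr1.
- by move=> a w w'; rewrite dil_lin increment_lin.
- by move=> w [Lw /(L2_increment_dil s0 Lw)[]]; rewrite mulr1.
Qed.

Notation Om := (`]- 2^-1, 2^-1[%classic : set R).

Lemma logspace_dil_unit (L : R) u : 0 < L -> logspace Om u ->
  logspace `]- L, L[ (dil (2 * L) u).
Proof.
move=> L0 Du; have s0 : 0 < 2 * L by rewrite mulr_gt0.
have sL : 2 * L * 2^-1 = L by rewrite mulrAC divff// mul1r.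
by have := logspace_dil s0 Du; rewrite sL.
Qed.

Lemma logspace_dilV (L : R) v : 0 < L -> logspace `]- L, L[ v ->
  logspace Om (dil (2 * L)^-1 v).
Proof.
move=> L0 Dv; have s0 : 0 < (2 * L)^-1 by rewrite invr_gt0 mulr_gt0.
have sL : (2 * L)^-1 * L = 2^-1 by rewrite invfM -mulrA mulVf ?mulr1// gt_eqF.
by have := logspace_dil s0 Dv; rewrite sL.
Qed.

(** On (-L, L) the truncation radius 2 L turns into 1 under the dilation, leaving
    2 ln (2 L) in the constant of [log_formE]. *)
Lemma log_form_dil (L : R) u v : 0 < L -> logspace Om u -> logspace Om v ->
  log_form (dil (2 * L) u) (dil (2 * L) v) =
    2 * L * (log_form u v - 2 * ln (2 * L) * ip mu u v).
Proof.
move=> L0 Du Dv; have s0 : 0 < 2 * L by rewrite mulr_gt0.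
have Dsu := logspace_dil_unit L0 Du; have Dsv := logspace_dil_unit L0 Dv.
have [Lu Lv] := (logspace_L2 Du, logspace_L2 Dv).
have [iu iv] := (logspace_increment Du, logspace_increment Dv).
by rewrite (log_formE L0 Dsu Dsv) log_form_unitE// ip_dil// ip_increment_dil//; ring.
Qed.

Lemma eigenspaceP (L l : R) u : eigenspace `]- L, L[ l u <->
  logspace `]- L, L[ u /\ forall v, logspace `]- L, L[ v -> log_form u v = l * ip mu u v.
Proof.
suff E v : logspace `]- L, L[ u -> logspace `]- L, L[ v ->
    \int[mu]_(x in `]- L, L[) (u x * v x) = ip mu u v.
  split=> -[Du h]; (split; first exact: Du) => v Dv.
    by rewrite (h v Dv) (E v Du Dv).
  by rewrite (h v Dv) (E v Du Dv).
move=> /logspaceP[Lu u0 _] /logspaceP[Lv _ _].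
have [mu' mv] := (L2_measurable Lu, L2_measurable Lv).
have muv : measurable_fun setT (fun x => u x * v x) by exact: measurable_funM.
rewrite Rintegral_mkcond; apply: eq_ae_Rintegral => //.
- apply/(measurable_restrictT _ _).1; first exact: measurable_itv.
  exact: measurable_funTS.
- apply: (@filterS _ _ (ae_filter_ringOfSetsType mu) _ _ _ u0) => x h.
  rewrite patchE; case: ifPn => // /negP xL; rewrite h ?mul0r// => xin.
  by apply: xL; rewrite inE.
Qed.

End EigenspaceDilation.

(** * Eigenvalues on all intervals *)

Section Main.
Context (R : realType).
Notation mu := (@lebesgue_measure R).
Notation Om := (`]- 2^-1, 2^-1[%classic : set R).
Notation unit_eigenvector := (eigenvector (logspace Om) (ip mu) (@log_form R)).

Lemma eigenvector_dil (L l : R) u : 0 < L -> unit_eigenvector l u ->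
  eigenspace `]- L, L[ (l - 2 * ln (2 * L)) (dil (2 * L) u).
Proof.
move=> L0 [Du uE]; have s0 : 0 < 2 * L by rewrite mulr_gt0.
have sn : 2 * L != 0 by rewrite gt_eqF.
apply/eigenspaceP; split; first exact: logspace_dil_unit.
move=> v Dv; have Dv' := logspace_dilV L0 Dv.
rewrite -(dilVK sn v) log_form_dil// uE// ip_dil//; [|exact: logspace_L2 Du|exact: logspace_L2 Dv'].
ring.
Qed.

Lemma eigenvector_dilV (L l : R) w : 0 < L ->
  eigenspace `]- L, L[ (l - 2 * ln (2 * L)) w ->
  unit_eigenvector l (dil (2 * L)^-1 w).
Proof.
move=> L0 /eigenspaceP[Dw wE]; have s0 : 0 < 2 * L by rewrite mulr_gt0.
have sn : 2 * L != 0 by rewrite gt_eqF.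
have Dw' := logspace_dilV L0 Dw.
split => // v Dv.
have := wE _ (logspace_dil_unit L0 Dv); rewrite -{1 2}(dilVK sn w) log_form_dil// ip_dil//;
  [|exact: logspace_L2 Dw'|exact: logspace_L2 Dv].
by rewrite mulrCA => /(mulfI sn); rewrite mulrBl => /(addIr _).
Qed.

Lemma multiplicity_dil (L l : R) n (f : 'I_n -> R -> R) : 0 < L ->
  (forall j, unit_eigenvector l (f j)) ->
  (forall i j, ip mu (f i) (f j) = (i == j)%:R) ->
  (forall u, unit_eigenvector l u ->
    ip mu (u - \sum_j ip mu u (f j) *: f j) (u - \sum_j ip mu u (f j) *: f j) = 0) ->
  has_multiplicity `]- L, L[ (l - 2 * ln (2 * L)) n.
Proof.
move=> L0 fE fO fspan; have s0 : 0 < 2 * L by rewrite mulr_gt0.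
have sn : 2 * L != 0 by rewrite gt_eqF.
have subD := logspace_subspace Om; have subL := L2_subspace mu.
have symL := ip_sym_bilinear mu.
have Df j : logspace Om (f j) by have [] := fE j.
have Lf j : L2 mu (f j) := logspace_L2 (Df j).
have sumE m (c : 'I_m -> R) (g : 'I_m -> R -> R) x :
    (\sum_(j < m) c j *: g j) x = \sum_(j < m) c j * g j x.
  by rewrite fct_sumE; apply: eq_bigr.
exists (fun j => dil (2 * L) (f j)); split.
- by move=> j; exact: eigenvector_dil.
- move=> c c0 i.
  pose g j := dil (2 * L) (f j).
  have Lg j : L2 mu (g j) by exact: L2_dil.
  have Lcg j : L2 mu (c j *: g j) by exact: (subspaceZ subL).
  have Lsum : L2 mu (\sum_j c j *: g j) by exact: (subspace_sum subL).
  have h : ip mu (\sum_j c j *: g j) (g i) = ip mu 0 (g i).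
    apply: eq_ae_ip => //; first exact: subspace0 subL.
    by apply: (@filterS _ _ (ae_filter_ringOfSetsType mu) _ _ _ c0) => x; rewrite sumE.
  move: h; rewrite (bil0l subL symL)// (bil_suml subL symL)//.
  rewrite (bigD1 i)//= big1 => [|j ji].
    rewrite (bilZl subL symL)// ip_dil// fO eqxx mulr1 addr0 => /eqP.
    by rewrite mulf_eq0 (negPf sn) orbF => /eqP.
  by rewrite (bilZl subL symL)// ip_dil// fO (negPf ji) !mulr0.
- move=> u /(eigenvector_dilV L0); set u' := dil _ u => u'E.
  have Lu' : L2 mu u' by have [/logspace_L2] := u'E.
  exists (fun j => ip mu u' (f j)).
  have Lsum : L2 mu (\sum_j ip mu u' (f j) *: f j).
    by apply: (subspace_sum subL) => j _; exact: (subspaceZ subL).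
  have := ae_dil s0 (ip_eq0 (subspaceB subL Lu' Lsum) (fspan _ u'E)).
  apply: (@filterS _ _ (ae_filter_ringOfSetsType mu)) => x /=.
  rewrite -[(_ - _) _]/(u' (x / (2 * L)) - (\sum_j ip mu u' (f j) *: f j) (x / (2 * L))).
  by rewrite sumE /u' /dil invrK divfK// => /subr0_eq.
Qed.

Lemma unit_spectrum : exists (e : nat -> R -> R) (lam : nat -> R),
  [/\ forall n, unit_eigenvector (lam n) (e n) /\ ip mu (e n) (e n) = 1,
      lam 0%N < lam 1%N, forall n, lam n <= lam n.+1, lam n @[n --> \oo] --> +oo &
      forall l L, 0 < L -> exists2 n, has_multiplicity `]- L, L[ (l - 2 * ln (2 * L)) n &
        [set i | lam i = l] #= `I_n].
Proof.
have subD := logspace_subspace Om; have symb := ip_sym_bilinear_logspace Om.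
have symE := @log_form_sym_bilinear R.
have b_ge0 u : logspace Om u -> 0 <= ip mu u u by move=> /logspace_L2; exact: ip_ge0.
have [e [lam [De eO eE lamy emin]]] := eigenbasis subD symb symE b_ge0
  (@log_form_lower R) (@log_form_compact R) (@logspace_tents R)
  (@tents_ortho R) (@tents_gt0 R).
exists e, lam; split => //.
- by move=> n; split; [split => // v; exact: eE|rewrite eO eqxx].
- have [le01 min0] := emin 0%N.
  rewrite lt_neqAle le01 andbT; apply/eqP => lam01.
  apply: (@bottom_simple R (e 0%N) (e 1%N) (lam 0%N)) => //; rewrite ?eO//.
  + by move=> v; exact: eE.
  + by move=> v; rewrite lam01; exact: eE.
  + by move=> v Dv; apply: min0.
- by move=> n; have [] := emin n.
- move=> l L L0.
  have [n [f [fE fO card_n fspan]]] := eigenspace_basis subD symb symE b_ge0 De eO eE lamy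
    (fun n => (emin n).2) l.
  by exists n => //; exact: (@multiplicity_dil L l n f).
Qed.

End Main.

Unset Implicit Arguments.

Theorem proposition7p1 (R : realType) :
  exists Ls : nat -> R,
    [/\ forall i, 0 < Ls i,
        forall i, is_eigenvalue `]- Ls i, Ls i[ 0 &
        forall L : R, 0 < L ->
          eigenvalue_sequence `]- L, L[ (fun i => 2 * ln (Ls i / L))].
Proof.
have [e [lam [eE lam01 lamS lamy lam_mult]]] := unit_spectrum R.
pose Ls i := expR (lam i / 2) / 2.
have Ls0 i : 0 < Ls i by rewrite divr_gt0 ?expR_gt0.
have lnLs L i : 0 < L -> 2 * ln (Ls i / L) = lam i - 2 * ln (2 * L).
  move=> L0; rewrite /Ls -mulrA -invfM ln_div ?posrE ?expR_gt0 ?mulr_gt0//.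
  rewrite expRK; lra.
exists Ls; split => //.
- move=> i; have := eigenvector_dil (Ls0 i) (eE i).1.
  rewrite -lnLs// divff ?gt_eqF// ln1 mulr0 => eig.
  exists (dil (2 * Ls i) (e i)) => // ae0.
  have s0 : 0 < 2 * Ls i by rewrite mulr_gt0.
  have Le : L2 lebesgue_measure (e i) by have [[/logspace_L2]] := eE i.
  have : ip lebesgue_measure (dil (2 * Ls i) (e i)) (dil (2 * Ls i) (e i)) =
      ip lebesgue_measure (0 : R -> R) (dil (2 * Ls i) (e i)).
    have subL := L2_subspace (@lebesgue_measure R).
    by apply: eq_ae_ip => //; [exact: L2_dil|exact: subspace0 subL|exact: L2_dil].
  rewrite (bil0l (L2_subspace _) (ip_sym_bilinear _)); last exact: L2_dil.
  by rewrite ip_dil_diag// (eE i).2 mulr1 => /eqP; rewrite gt_eqF.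
- move=> L L0.
  have -> : (fun i => 2 * ln (Ls i / L)) = (fun i => lam i - 2 * ln (2 * L)).
    by apply/funext => i; exact: lnLs.
  split.
  + by rewrite ltrD2r.
  + by move=> i; rewrite lerD2r.
  + apply/cvgryPge => A; have /cvgryPge/(_ (A + 2 * ln (2 * L))) := lamy.
    by apply: filterS => n; rewrite lerBrDr.
  + move=> l; have [n mult card_n] := lam_mult (l + 2 * ln (2 * L)) L L0.
    exists n; first by rewrite addrK in mult.
    rewrite (_ : [set i | _] = [set i | lam i = l + 2 * ln (2 * L)])//.
    by apply/seteqP; split => i /= h; [rewrite -h subrK|rewrite h addrK].
Qed.
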